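(* There exists a universal constant $\eta_0>0.0006$ such that for every constant positive integer $z$ there is an algorithm for Robust $(k,z)$-Clustering in discrete Euclidean space $\mathbb{R}^d$ that has approximation factor $3^z(1-\eta_0)$ and runs in time $2^{O(k\log k)}\,\mathrm{poly}(m,n,d)$. That is, given any instance with $P,F\subseteq\mathbb{R}^d$ finite and $\delta$ the Euclidean distance, the algorithm outputs, within this time, a $k$-element set $X\subseteq F$ with $$\max_{i\in[m]}\sum_{p\in S_i}w(p)\,\delta(p,X)^z\;\le\;3^z(1-\eta_0)\cdot\min_{X'\subseteq F,\ |X'|=k}\ \max_{i\in[m]}\sum_{p\in S_i}w(p)\,\delta(p,X')^z .$$
   Context: Robust $(k,z)$-Clustering (for a constant $z\ge 1$): the input consists of a set $P$ of points (clients), a set $F$ of candidate centers (facilities), a metric $\delta$ on $P\cup F$, a positive integer $k$, a weight function $w:P\to\mathbb{R}_{+}$, and $m$ groups $S_1,\dots,S_m\subseteq P$ with $P=\bigcup_{i\in[m]}S_i$. The groups may overlap. The goal is to output a $k$-element subset $X\subseteq F$ minimizing $\max_{i\in[m]}\sum_{p\in S_i}w(p)\,\delta(p,X)^z$, where $\delta(p,X)=\min_{x\in X}\delta(p,x)$. Discrete Euclidean space $\mathbb{R}^d$: $P$ and $F$ are finite subsets of $\mathbb{R}^d$ and $\delta(x,y)=\|x-y\|_2$; the dimension $d$ is part of the input. Here $n=|P|$, and the factor polynomial in $m,n,d$ may also depend polynomially on $|F|$. *)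

(* Defs.v *)
From HB Require Import structures.
From mathcomp Require Import all_boot all_order all_algebra.
From mathcomp Require Import all_classical all_reals.
From mathcomp Require Import topology normedtype sequences exp.

Set Implicit Arguments.
Unset Strict Implicit.
Unset Printing Implicit Defensive.

Import Order.TTheory GRing.Theory Num.Theory.
Local Open Scope ring_scope.

Definition edist (R : realType) (d : nat) (x y : 'rV[R]_d) : R :=
  Num.sqrt (\sum_(j < d) (x 0 j - y 0 j) ^+ 2).

(* The finite sets P, F of R^d and the family of groups are given together
   with the order in which they are listed in the input.  P and F may meet,
   the groups may overlap (and coincide), and weights are nonnegative. *)
Record instance (R : realType) := Instance {
  dim : nat;
  npts : nat;
  nfac : nat;
  ngrp : nat;
  ncen : nat;
  pt : 'I_npts -> 'rV[R]_dim;
  fac : 'I_nfac -> 'rV[R]_dim;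
  wt : 'I_npts -> R;
  grp : 'I_ngrp -> {set 'I_npts};
  pt_inj : injective pt;
  fac_inj : injective fac;
  wt_ge0 : forall p, 0 <= wt p;
  grp_cover : \bigcup_(i < ngrp) grp i = [set: 'I_npts]%SET;
  ncen_gt0 : (0 < ncen)%N;
  ncen_le : (ncen <= nfac)%N }.

(* The infimum ranges over a finite family, nonempty as soon as X is, so it is
   a minimum (see [dist_to_attained]). *)
Definition dist_to (R : realType) (I : instance R) (X : {set 'I_(nfac I)})
    (p : 'I_(npts I)) : R :=
  inf [set edist (pt p) (fac x) | x in [set x | x \in X]]%classic.

(* All the terms are nonnegative, so 0 is harmless as the neutral element. *)
Definition cost (R : realType) (I : instance R) (z : nat)
    (X : {set 'I_(nfac I)}) : R :=
  \big[Num.max/0]_(i < ngrp I)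
    \sum_(p in @grp R I i) wt p * dist_to X p ^+ z.

(* Again a minimum over a finite nonempty family (see [opt_attained]). *)
Definition opt (R : realType) (I : instance R) (z : nat) : R :=
  inf [set cost z X | X in [set X : {set 'I_(nfac I)} | #|X| = ncen I]]%classic.

(** * The real RAM

   Algorithms are programs of a deterministic unit-cost real RAM.  Memory
   consists of integer arrays and real arrays, each an infinite sequence of
   cells, named by the numerals that occur in the program text; a program can
   therefore only use finitely many arrays, and indirect addressing is the
   access to a cell whose index is computed.
   - Real cells hold exact reals, with +, -, *, /, square root and comparison.
     There is no conversion from reals to integers (no rounding), and programs
     contain no real constants.
   - Integer operations are only addition and truncated subtraction, so that
     integers computed in t steps have O(t) bits.
   - Every assignment and every test costs 1; expressions have a size bounded
     in terms of the program alone, so this is, up to a constant factor, the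
     number of elementary operations. *)

Inductive nexp :=
  | NConst of nat
  | NGet of nat & nexp
  | NAdd of nexp & nexp
  | NSub of nexp & nexp.

Inductive rexp :=
  | RNat of nexp
  | RGet of nat & nexp
  | RAdd of rexp & rexp
  | RSub of rexp & rexp
  | RMul of rexp & rexp
  | RDiv of rexp & rexp
  | RSqrt of rexp.

Inductive bexp :=
  | BLeN of nexp & nexp
  | BLeR of rexp & rexp
  | BNot of bexp
  | BAnd of bexp & bexp.

Inductive cmd :=
  | CSkip
  | CSetN of nat & nexp & nexp
  | CSetR of nat & nexp & rexp
  | CSeq of cmd & cmd
  | CIf of bexp & cmd & cmd
  | CWhile of bexp & cmd.

Record state (R : realType) := State {
  ints : nat -> nat -> nat;
  reals : nat -> nat -> R }.

Fixpoint evalN (R : realType) (s : state R) (e : nexp) : nat :=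
  match e with
  | NConst c => c
  | NGet a e1 => ints s a (evalN s e1)
  | NAdd e1 e2 => (evalN s e1 + evalN s e2)%N
  | NSub e1 e2 => (evalN s e1 - evalN s e2)%N
  end.

Fixpoint evalR (R : realType) (s : state R) (e : rexp) : R :=
  match e with
  | RNat e1 => (evalN s e1)%:R
  | RGet a e1 => reals s a (evalN s e1)
  | RAdd e1 e2 => evalR s e1 + evalR s e2
  | RSub e1 e2 => evalR s e1 - evalR s e2
  | RMul e1 e2 => evalR s e1 * evalR s e2
  | RDiv e1 e2 => evalR s e1 / evalR s e2
  | RSqrt e1 => Num.sqrt (evalR s e1)
  end.

Fixpoint evalB (R : realType) (s : state R) (b : bexp) : bool :=
  match b with
  | BLeN e1 e2 => (evalN s e1 <= evalN s e2)%N
  | BLeR e1 e2 => evalR s e1 <= evalR s e2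
  | BNot b1 => ~~ evalB s b1
  | BAnd b1 b2 => evalB s b1 && evalB s b2
  end.

Definition upd (T : Type) (f : nat -> nat -> T) (a i : nat) (v : T) :=
  fun b j => if (b == a) && (j == i) then v else f b j.

(* [exec c s t s']: started in memory s, the program c halts after t steps
   with memory s'. *)
Inductive exec (R : realType) : cmd -> state R -> nat -> state R -> Prop :=
  | ExecSkip s : exec CSkip s 1 s
  | ExecSetN s a i e :
      exec (CSetN a i e) s 1
        (State (upd (ints s) a (evalN s i) (evalN s e)) (reals s))
  | ExecSetR s a i e :
      exec (CSetR a i e) s 1
        (State (ints s) (upd (reals s) a (evalN s i) (evalR s e)))
  | ExecSeq c1 c2 s s1 s2 t1 t2 :
      exec c1 s t1 s1 -> exec c2 s1 t2 s2 ->
      exec (CSeq c1 c2) s (t1 + t2) s2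
  | ExecIf b c1 c2 s s1 t :
      exec (if evalB s b then c1 else c2) s t s1 ->
      exec (CIf b c1 c2) s t.+1 s1
  | ExecWhileF b c s :
      ~~ evalB s b -> exec (CWhile b c) s 1 s
  | ExecWhileT b c s s1 s2 t1 t2 :
      evalB s b -> exec c s t1 s1 -> exec (CWhile b c) s1 t2 s2 ->
      exec (CWhile b c) s (t1 + t2).+1 s2.

(** * Input and output conventions

   Integer array 0: n, |F|, m, d, k in cells 0 to 4.
   Integer array 1: incidence matrix of the groups, row by row.
   Real arrays 0 and 1: coordinates of the points of P and of F, row by row.
   Real array 2: weights.
   All other cells are initially 0.
   Output, in integer array 2: the j-th facility is selected iff cell j is
   nonzero. *)

Definition rowmajor (T : Type) (x0 : T) (a b : nat) (f : 'I_a -> 'I_b -> T)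
    (c : nat) : T :=
  nth x0 (flatten [seq [seq f i j | j <- enum 'I_b] | i <- enum 'I_a]) c.

Definition input (R : realType) (I : instance R) : state R :=
  State
    (fun a c => match a with
      | 0 => nth 0%N [:: npts I; nfac I; ngrp I; dim I; ncen I] c
      | 1 => rowmajor 0%N (fun i p => nat_of_bool (p \in @grp R I i)) c
      | _ => 0%N
      end)
    (fun a c => match a with
      | 0 => rowmajor 0 (fun p j => @pt R I p 0 j) c
      | 1 => rowmajor 0 (fun x j => @fac R I x 0 j) c
      | 2 => nth 0 [seq @wt R I p | p <- enum 'I_(npts I)] c
      | _ => 0
      end).

Definition output (R : realType) (I : instance R) (s : state R) :
    {set 'I_(nfac I)} :=
  [set x : 'I_(nfac I) | ints s 2 x != 0%N]%SET.

Definition approximates (R : realType) (A : cmd) (z : nat) (alpha : R) : Prop :=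
  forall (I : instance R) (t : nat) (s : state R),
    exec A (input I) t s ->
    #|output I s| = ncen I /\ cost z (output I s) <= alpha * opt I z.

(* 2^{O(k log k)} poly(m, n, d, |F|): finitely many exceptional k in the O, and
   the base of the logarithm, are absorbed by c. *)
Definition fpt_time (R : realType) (A : cmd) : Prop :=
  exists c e : nat, forall I : instance R, exists (t : nat) (s : state R),
    exec A (input I) t s /\
    t%:R <= (2 : R) `^ (c%:R * ((ncen I)%:R * ln (ncen I)%:R))
            * (c * (ngrp I + npts I + dim I + nfac I + 1) ^ e)%:R.

Lemma inf_fin_attained (R : realType) (T : finType) (f : T -> R)
    (A : {pred T}) : (exists x, x \in A) ->
  exists2 x, x \in A & inf [set f y | y in [set y | y \in A]]%classic = f x /\
    forall y, y \in A -> f x <= f y.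
Proof.
case=> x0 x0A; case: (arg_minP f x0A) => x xA xmin.
exists x => //; split; last exact: xmin.
apply/eqP; rewrite eq_le; apply/andP; split.
  apply: ge_inf; last by exists x.
  by exists (f x) => _ [y yA <-]; exact: xmin.
apply: lb_le_inf; first by exists (f x), x.
by move=> _ [y yA <-]; exact: xmin.
Qed.

Lemma dist_to_attained (R : realType) (I : instance R)
    (X : {set 'I_(nfac I)}) (p : 'I_(npts I)) : (0 < #|X|)%N ->
  exists2 x, x \in X & dist_to X p = edist (pt p) (fac x) /\
    forall y, y \in X -> edist (pt p) (fac x) <= edist (pt p) (fac y).
Proof. by move/card_gt0P => X0; exact: inf_fin_attained. Qed.

Lemma opt_attained (R : realType) (I : instance R) (z : nat) :
  exists2 X : {set 'I_(nfac I)}, #|X| = ncen I & opt I z = cost z X /\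
    forall Y : {set 'I_(nfac I)}, #|Y| = ncen I -> cost z X <= cost z Y.
Proof.
have [X0 X0k] : exists X : {set 'I_(nfac I)}, #|X| = ncen I.
  have := ncen_le I; rewrite -[X in (_ <= X)%N]card_ord -cardsT.
  by case/card_geqP => s [us ss _]; exists [set:: s]%SET; rewrite cardsE (card_uniqP us).
have [|X /eqP Xk [optE Xmin]] := @inf_fin_attained R _ (@cost R I z)
  [pred X : {set 'I_(nfac I)} | #|X| == ncen I].
  by exists X0; rewrite inE X0k.
exists X => //; split; last by move=> Y /eqP Yk; exact: Xmin.
rewrite /opt -optE; congr (inf (image _ _)).
by apply/seteqP; split=> Y /= /eqP.
Qed.

Lemma exec_det (R : realType) (c : cmd) (s : state R) (t1 t2 : nat)
    (s1 s2 : state R) :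
  exec c s t1 s1 -> exec c s t2 s2 -> t1 = t2 /\ s1 = s2.
Proof.
move=> H; elim: H t2 s2 => {c s t1 s1}.
- by move=> s t2 s2 H; inversion H.
- by move=> s a i e t2 s2 H; inversion H.
- by move=> s a i e t2 s2 H; inversion H.
- move=> c1 c2 s s1 s2 t1 t2 _ IH1 _ IH2 t3 s3 H; inversion H; subst.
  match goal with K : exec c1 _ _ _ |- _ => have [? ?] := IH1 _ _ K end; subst.
  by match goal with K : exec c2 _ _ _ |- _ => have [? ?] := IH2 _ _ K end; subst.
- move=> b c1 c2 s s1 t _ IH t3 s3 H; inversion H; subst.
  by match goal with K : exec (if _ then _ else _) _ _ _ |- _ =>
    have [? ?] := IH _ _ K end; subst.
- move=> b c s /negbTE nb t3 s3 H; inversion H; subst => //; congruence.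
- move=> b c s s1 s2 t1 t2 bs _ IH1 _ IH2 t3 s3 H; inversion H; subst.
    by match goal with K : is_true (~~ evalB _ _) |- _ => rewrite bs in K end.
  match goal with K : exec c _ _ _ |- _ => have [? ?] := IH1 _ _ K end; subst.
  by match goal with K : exec (CWhile b c) _ _ _ |- _ =>
    have [? ?] := IH2 _ _ K end; subst.
Qed.

Lemma rowmajorE (T : Type) (x0 : T) (a b : nat) (f : 'I_a -> 'I_b -> T)
    (i : 'I_a) (j : 'I_b) : rowmajor x0 f (i * b + j) = f i j.
Proof.
have szb k : size [seq f k l | l <- enum 'I_b] = b by rewrite size_map size_enum_ord.
suff gen (r : seq 'I_a) m : (m < size r)%N ->
    nth x0 (flatten [seq [seq f k l | l <- enum 'I_b] | k <- r]) (m * b + j)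
    = f (nth i r m) j.
  by rewrite /rowmajor gen ?size_enum_ord// nth_ord_enum.
elim: r m => // k r IH [|m] mr /=; rewrite nth_cat szb.
  by rewrite mul0n add0n ltn_ord (nth_map j) ?size_enum_ord// nth_ord_enum.
by rewrite mulSn -addnA ltnNge leq_addr addKn IH.
Qed.

(* Main.v *)
(* Let phi be the connection costs w(p) delta(p,L)^z truncated at 2g, and let the
   potential of L be the sum over the groups of the excess of their truncated
   cost over g.  If g is at least the optimum, some facility of an optimal
   solution decreases the potential by the factor 1 - 1/k, so greedy choices
   give, after O(k log (mn)) steps, a list L all of whose group costs are at
   most 17/16 g.  Trying the multiples of 1/16 of all connection costs
   w(p) delta(p,x)^z finds a g within 17/16 of the optimum.

   Let o be an optimal center and x the element of L nearest to o.  If o is far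
   from the midpoint of x and every y in L, then Ptolemy's inequality gives
   |p - x| <= 11/6 |p - o| + |p - y|, where the triangle inequality would give
   2 |p - o| + |p - y|.  Otherwise, the facility nearest to one of these
   midpoints is so close to o that the same bound holds for it.  Hence trying
   all k-tuples of facilities nearest to midpoints of two elements of L gives
   the factor (17/6)^(z-1) (11/6 + (17/16)^2), which is at most 3^z (1 - 1/100).
   There are (O(k log (mn))^2)^k such tuples, and (log N)^j <= j^j N. *)
Require Import Defs.
From mathcomp Require Import all_boot all_order all_algebra.
From mathcomp Require Import all_classical all_reals.
From mathcomp Require Import sequences exp zify ring lra.

Set Implicit Arguments.
Unset Strict Implicit.
Unset Printing Implicit Defensive.

Import Order.TTheory GRing.Theory Num.Theory.
Local Open Scope ring_scope.


(** * Structured programs *)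

(** By Ptolemy's inequality the coefficient 2 in 2 |p - o| + |p - y| is approached only if |x - y|
    is close to 2 |y - o|, that is, if o is close to the midpoint of x and y; this is why facilities
    near midpoints join the candidates. The candidate may depend on o only, whereas the y in L that
    serves p depends on p, so the improved bound has to hold for one candidate and all y in L at
    once. Convexity of the z-th power turns coefficients u, v into (u + v)^(z-1) (u + v c), where c
    is the cost of L relative to the optimum; u = 2 and v = c = 1 would give 3^z. Truncation at 2g
    serves twice: it bounds the initial potential by 2gmn, so that the number of greedy steps is
    independent of the magnitudes, and a final group cost below 2g proves that each point is really
    connected to L. The machine shapes the rest. It has no rounding, so guesses are read off the
    table of connection costs; it has no integer multiplication, so products, addresses and digits
    come from repeated addition and subtraction. Counted loops with fixed bounds make termination
    and running time syntactic. *)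

(* [PFor i e p] runs [p] with cell 0 of integer array [i] equal to
   0, ..., e - 1; the absence of other loops makes every program terminate. *)
Inductive prog :=
  | PSkip
  | PSetN of nat & nexp & nexp
  | PSetR of nat & nexp & rexp
  | PSeq of prog & prog
  | PIf of bexp & prog & prog
  | PFor of nat & nexp & prog.

Notation Z0 := (NConst 0).
Notation VN a := (NGet a Z0).
Notation VR a := (RGet a Z0).

Fixpoint compile (p : prog) : cmd :=
  match p with
  | PSkip => CSkip
  | PSetN a i e => CSetN a i e
  | PSetR a i e => CSetR a i e
  | PSeq p q => CSeq (compile p) (compile q)
  | PIf b p q => CIf b (compile p) (compile q)
  | PFor i e p => CSeq (CSetN i Z0 Z0)
      (CWhile (BNot (BLeN e (VN i)))
         (CSeq (compile p) (CSetN i Z0 (NAdd (VN i) (NConst 1)))))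
  end.

Fixpoint modN (p : prog) : seq nat :=
  match p with
  | PSetN a _ _ => [:: a]
  | PSeq p q | PIf _ p q => modN p ++ modN q
  | PFor i _ p => i :: modN p
  | _ => [::]
  end.

Fixpoint modR (p : prog) : seq nat :=
  match p with
  | PSetR a _ _ => [:: a]
  | PSeq p q | PIf _ p q => modR p ++ modR q
  | PFor _ _ p => modR p
  | _ => [::]
  end.

Fixpoint rdN (e : nexp) : seq nat :=
  match e with
  | NConst _ => [::]
  | NGet a e => a :: rdN e
  | NAdd e f | NSub e f => rdN e ++ rdN f
  end.

Fixpoint bnds (p : prog) : seq nat :=
  match p with
  | PSeq p q | PIf _ p q => bnds p ++ bnds q
  | PFor _ e p => rdN e ++ bnds p
  | _ => [::]
  end.

Fixpoint counters_ok (p : prog) : bool :=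
  match p with
  | PSeq p q | PIf _ p q => counters_ok p && counters_ok q
  | PFor i _ p => (i \notin modN p) && counters_ok p
  | _ => true
  end.

(** The compiled loop is a [CWhile] that reevaluates its bound and reads its counter in every round.
    It agrees with a loop whose length is fixed on entry as soon as bodies leave their counters
    alone and bounds read only arrays that the program never writes. *)
Definition wf (p : prog) : bool :=
  counters_ok p && all (fun a => a \notin modN p) (bnds p).

Section Semantics.
Variable R : realType.
Implicit Types (s : state R) (p q : prog).

Definition setN s a i v := State (upd (ints s) a i v) (reals s).
Definition setR s a i v := State (ints s) (upd (reals s) a i v).

Fixpoint den p s : state R :=
  match p with
  | PSkip => s
  | PSetN a i e => setN s a (evalN s i) (evalN s e)
  | PSetR a i e => setR s a (evalN s i) (evalR s e)
  | PSeq p q => den q (den p s)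
  | PIf b p q => if evalB s b then den p s else den q s
  | PFor i e p =>
      iteri (evalN s e) (fun j s => setN (den p s) i 0 j.+1) (setN s i 0 0)
  end.

(* An upper bound on the running time, computed in the initial memory: loop
   bounds are not modified by the program. *)
Fixpoint cost_bound s p : nat :=
  match p with
  | PSeq p q => cost_bound s p + cost_bound s q
  | PIf _ p q => (cost_bound s p + cost_bound s q).+1
  | PFor _ e p => evalN s e * (cost_bound s p + 2) + 2
  | _ => 1
  end.

Definition agree (WN WR : seq nat) s s' :=
  (forall a, a \notin WN -> ints s' a = ints s a) /\
  (forall a, a \notin WR -> reals s' a = reals s a).

Lemma agree_trans WN WR s1 s2 s3 :
  agree WN WR s1 s2 -> agree WN WR s2 s3 -> agree WN WR s1 s3.
Proof.
move=> [a1 b1] [a2 b2]; split=> a H; first by rewrite a2 // a1.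
by rewrite b2 // b1.
Qed.

Lemma agree_sub WN WR WN' WR' s s' : {subset WN <= WN'} -> {subset WR <= WR'} ->
  agree WN WR s s' -> agree WN' WR' s s'.
Proof.
move=> sN sR [a b]; split=> x xW; first by apply: a; apply: contra xW; apply: sN.
by apply: b; apply: contra xW; apply: sR.
Qed.

Lemma agree_setN WN WR s a i v : a \in WN -> agree WN WR s (setN s a i v).
Proof.
move=> aW; split=> // b bW; rewrite /= /upd.
by have /negbTE -> : b != a by apply: contraNneq bW => ->.
Qed.

Lemma agree_setR WN WR s a i v : a \in WR -> agree WN WR s (setR s a i v).
Proof.
move=> aW; split=> // b bW; rewrite /= /upd.
by have /negbTE -> : b != a by apply: contraNneq bW => ->.
Qed.

Lemma den_agree p s : agree (modN p) (modR p) s (den p s).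
Proof.
elim: p s => //= [a i e|a i e|p IHp q IHq|b p IHp q IHq|i e p IH] s.
- by apply: agree_setN; rewrite mem_head.
- by apply: agree_setR; rewrite mem_head.
- apply: agree_trans (agree_sub _ _ (IHp s)) (agree_sub _ _ (IHq _)) => x xW;
    by rewrite mem_cat xW ?orbT.
- case: ifP => _; [apply: agree_sub (IHp s)|apply: agree_sub (IHq s)] => x xW;
    by rewrite mem_cat xW ?orbT.
- elim: (evalN s e) => [|j IHj] /=; first by apply: agree_setN; rewrite mem_head.
  apply: (agree_trans IHj); apply: agree_trans (agree_setN _ _ _ _ _);
    last by rewrite mem_head.
  by apply: agree_sub (IH _) => // x xW; rewrite inE xW orbT.
Qed.

Lemma den_ints p s a : a \notin modN p -> ints (den p s) a = ints s a.
Proof. by case: (den_agree p s) => + _; apply. Qed.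

Lemma den_reals p s a : a \notin modR p -> reals (den p s) a = reals s a.
Proof. by case: (den_agree p s) => _; apply. Qed.

(** Besides the invariant, each round may use the value of the counter and the agreement with the
    initial memory on all unwritten arrays, so that invariants only mention what changes. *)
Lemma for_inv i e p s (P : nat -> state R -> Prop) : i \notin modN p ->
  P 0%N (setN s i 0 0) ->
  (forall j s', (j < evalN s e)%N -> ints s' i 0 = j ->
     agree (i :: modN p) (modR p) s s' -> P j s' ->
     P j.+1 (setN (den p s') i 0 j.+1)) ->
  P (evalN s e) (den (PFor i e p) s).
Proof.
move=> ip P0 PS /=; set f := (X in iteri _ X _).
suff : forall j, (j <= evalN s e)%N -> let s' := iteri j f (setN s i 0 0) in
    [/\ ints s' i 0 = j, agree (i :: modN p) (modR p) s s' & P j s'].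
  by move=> /(_ _ (leqnn _)) [].
elim=> [_|j IH jn] /=.
  by split=> //; [rewrite /upd !eqxx|apply: agree_setN; rewrite mem_head].
have [ij aj Pj] := IH (ltnW jn).
split; [by rewrite /upd !eqxx| |exact: PS].
apply: (agree_trans aj); apply: agree_trans (agree_setN _ _ _ _ _);
  last by rewrite mem_head.
by apply: agree_sub (den_agree _ _) => // x xW; rewrite inE xW orbT.
Qed.

Lemma for_invE N i e p s (P : nat -> state R -> Prop) : evalN s e = N ->
  i \notin modN p -> P 0%N (setN s i 0 0) ->
  (forall j s', (j < N)%N -> ints s' i 0 = j ->
     agree (i :: modN p) (modR p) s s' -> P j s' ->
     P j.+1 (setN (den p s') i 0 j.+1)) ->
  P N (den (PFor i e p) s).
Proof. by move=> <-; exact: for_inv. Qed.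

Lemma denE :
  (forall p q s, den (PSeq p q) s = den q (den p s)) *
  (forall a i e s, den (PSetN a i e) s = setN s a (evalN s i) (evalN s e)) *
  (forall a i e s, den (PSetR a i e) s = setR s a (evalN s i) (evalR s e)) *
  (forall b p q s, den (PIf b p q) s = if evalB s b then den p s else den q s) *
  (forall s, den PSkip s = s).
Proof. by []. Qed.

Lemma evalN_agree WN WR s s' e : agree WN WR s s' ->
  all (fun a => a \notin WN) (rdN e) -> evalN s' e = evalN s e.
Proof.
move=> [aN _]; elim: e => //= [a e IH /andP[/aN -> /IH ->]|e IHe f IHf|e IHe f IHf] //;
  by rewrite all_cat => /andP[/IHe -> /IHf ->].
Qed.

(** [WN] and [WR] frame the enclosing program and [s0] is a memory that agrees with the current one
    outside this frame. Bounds of nested loops thus keep the value they have in [s0], where the time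
    is computed, however late the loop is reached. *)
Lemma exec_compile WN WR p s0 s : counters_ok p -> {subset modN p <= WN} ->
  all (fun a => a \notin WN) (bnds p) -> {subset modR p <= WR} -> agree WN WR s0 s ->
  exists2 t, exec (compile p) s t (den p s) & (t <= cost_bound s0 p)%N.
Proof.
elim: p s => /= [|a i e|a i e|p IHp q IHq|b p IHp q IHq|i e p IH] s.
- by exists 1%N => //; constructor.
- by exists 1%N => //; constructor.
- by exists 1%N => //; constructor.
- move=> /andP[cp cq] sN; rewrite all_cat => /andP[bp bq] sR a0.
  have [|||||t et tle] := IHp s => //.
    by move=> x xW; apply: sN; rewrite mem_cat xW.
    by move=> x xW; apply: sR; rewrite mem_cat xW.
  have [|||||u eu ule] := IHq (den p s) => //.
  + by move=> x xW; apply: sN; rewrite mem_cat xW orbT.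
  + by move=> x xW; apply: sR; rewrite mem_cat xW orbT.
  + apply: (agree_trans a0); apply: agree_sub (den_agree _ _) => x xW;
      by [apply: sN; rewrite mem_cat xW | apply: sR; rewrite mem_cat xW].
  by exists (t + u)%N; [apply: ExecSeq et eu|apply: leq_add].
- move=> /andP[cp cq] sN; rewrite all_cat => /andP[bp bq] sR a0.
  case E: (evalB s b).
    have [|||||t et tle] := IHp s => //.
      by move=> x xW; apply: sN; rewrite mem_cat xW.
      by move=> x xW; apply: sR; rewrite mem_cat xW.
    by exists t.+1; [apply: ExecIf; rewrite E|rewrite ltnS (leq_trans tle) ?leq_addr].
  have [|||||t et tle] := IHq s => //.
    by move=> x xW; apply: sN; rewrite mem_cat xW orbT.
    by move=> x xW; apply: sR; rewrite mem_cat xW orbT.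
  by exists t.+1; [apply: ExecIf; rewrite E|rewrite ltnS (leq_trans tle) ?leq_addl].
move=> /andP[ip cp] sN; rewrite all_cat => /andP[be bp] sR a0.
have spN : {subset modN p <= WN} by move=> x xW; apply: sN; rewrite inE xW orbT.
have iW : i \in WN by apply: sN; rewrite mem_head.
rewrite -(evalN_agree a0 be).
set n := evalN s e; set f := (X in iteri _ X _).
(* Induction on the number [j] of rounds still to come, because [ExecWhileT] puts a round in front
   of the remaining run. *)
have L j : (j <= n)%N -> let s1 := iteri (n - j) f (setN s i 0 0) in
    agree WN WR s0 s1 -> ints s1 i 0 = (n - j)%N ->
    exists2 t, exec (CWhile (BNot (BLeN e (VN i)))
         (CSeq (compile p) (CSetN i Z0 (NAdd (VN i) (NConst 1))))) s1 t
      (iteri n f (setN s i 0 0)) & (t <= j * (cost_bound s0 p + 2) + 1)%N.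
  elim: j => [_|j IHj jn] s1 a1 i1.
    rewrite subn0 in i1; exists 1%N => //.
    rewrite /s1 subn0; apply: ExecWhileF; rewrite /= -[in iteri _ _ _](subn0 n) -/s1.
    by rewrite (evalN_agree a1 be) -(evalN_agree a0 be) i1 leqnn.
  have [t et tle] := IH _ cp spN bp sR a1.
  have nj : (n - j = (n - j.+1).+1)%N by lia.
  have sS : iteri (n - j) f (setN s i 0 0) = setN (den p s1) i 0 (n - j.+1).+1.
    by rewrite nj.
  have [|||u eu ule] := IHj.
  - by lia.
  - rewrite sS; apply: (agree_trans a1); apply: agree_trans (agree_setN _ _ _ _ iW).
    exact: agree_sub (den_agree _ _).
  - by rewrite sS /= /upd !eqxx nj.
  exists (t + 1 + u).+1; last by lia.
  rewrite /= sS in eu; apply: (ExecWhileT _ _ eu).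
    by rewrite /= (evalN_agree a1 be) -(evalN_agree a0 be) i1 -ltnNge -/n; lia.
  apply: ExecSeq et _; rewrite -[X in setN _ _ _ X]addn1 -i1.
  rewrite -(proj1 (den_agree p s1) _ ip).
  exact: (ExecSetN (den p s1) i Z0 (NAdd (VN i) (NConst 1))).
have := L n (leqnn n); rewrite subnn /= => -[||t et tle].
- exact: agree_trans a0 (agree_setN _ _ _ _ iW).
- by rewrite /upd !eqxx.
exists (1 + t)%N; last by rewrite -/n; lia.
exact: ExecSeq (ExecSetN s i Z0 Z0) et.
Qed.

Lemma exec_wf p s : wf p ->
  exists2 t, exec (compile p) s t (den p s) & (t <= cost_bound s p)%N.
Proof.
by move=> /andP[c b]; apply: (exec_compile (WN := modN p) (WR := modR p)).
Qed.

End Semantics.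

Arguments den : simpl never.
Ltac simp := rewrite /= /upd /=.
Arguments den_ints {R} p s a _.
Arguments den_reals {R} p s a _.


(** * Geometry *)

Section Geometry.
Variables (R : realType) (d : nat).
Implicit Types u v w x y : nat -> R.

(** Vectors are functions on [nat] of which only the first [d] values count: this is how the program
    sees the rows of its flat arrays. *)
Definition dot u v := \sum_(0 <= j < d) u j * v j.
Definition nrm u := Num.sqrt (dot u u).
Definition dist x y := nrm (fun j => x j - y j).

Lemma dotC u v : dot u v = dot v u.
Proof. by apply: eq_bigr => j _; rewrite mulrC. Qed.

Lemma dot_lin a b u v w :
  dot (fun j => a * u j + b * v j) w = a * dot u w + b * dot v w.
Proof.
rewrite /dot !big_distrr -big_split; apply: eq_bigr => j _ /=; ring.
Qed.

Lemma dot_sq a b u v : dot (fun j => a * u j + b * v j) (fun j => a * u j + b * v j) =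
  a ^+ 2 * dot u u + a * b * dot u v *+ 2 + b ^+ 2 * dot v v.
Proof.
rewrite dot_lin !(dotC _ (fun j => _ + _)) !dot_lin (dotC v u); ring.
Qed.

Lemma dot_ge0 u : 0 <= dot u u.
Proof. by apply: sumr_ge0 => j _; rewrite -expr2 sqr_ge0. Qed.

Lemma nrm_ge0 u : 0 <= nrm u.
Proof. exact: sqrtr_ge0. Qed.

Lemma sqr_nrm u : nrm u ^+ 2 = dot u u.
Proof. by rewrite sqr_sqrtr ?dot_ge0. Qed.

Lemma nrm_le u c : 0 <= c -> dot u u <= c ^+ 2 -> nrm u <= c.
Proof. by move=> c0 h; rewrite -(ler_pXn2r (_ : 0 < 2)%N) ?nnegrE ?nrm_ge0 ?sqr_nrm. Qed.

Lemma dot_le u v : dot u v <= nrm u * nrm v.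
Proof.
have [a0 b0] := (nrm_ge0 u, nrm_ge0 v).
have := dot_ge0 (fun j => nrm v * u j + (- nrm u) * v j).
rewrite dot_sq -!sqr_nrm; set a := nrm u in a0 *; set b := nrm v in b0 *.
have [ab|ab] := ltrP 0 (a * b).
  move=> H; rewrite -(ler_pM2l ab); nra.
have {ab}ab0 : a * b = 0 by apply/eqP; rewrite eq_le ab mulr_ge0.
(* If [nrm u = 0], the vector (1 + b^2) u - <u,v> v has squared norm -(2 + b^2) <u,v>^2, which
   forces <u,v> = 0; symmetrically if [nrm v = 0]. *)
have [j0 | j0] : a = 0 \/ b = 0.
- by move/eqP: ab0; rewrite mulf_eq0 => /orP[] /eqP ->; [left|right].
- move=> _; rewrite ab0; have := dot_ge0 (fun j => 1 * u j + dot u v * v j).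
  have := dot_ge0 (fun j => (1 + b ^+ 2) * u j + (- dot u v) * v j).
  rewrite !dot_sq -!sqr_nrm -/a -/b j0 => H1 H2; nra.
- move=> _; rewrite ab0.
  have := dot_ge0 (fun j => - dot u v * u j + (1 + a ^+ 2) * v j).
  rewrite !dot_sq -!sqr_nrm -/a -/b j0 => H1; nra.
Qed.

Lemma nrm_lin_le a b u v :
  nrm (fun j => a * u j + b * v j) <= `|a| * nrm u + `|b| * nrm v.
Proof.
apply: nrm_le; first by rewrite addr_ge0 ?mulr_ge0 ?nrm_ge0.
rewrite dot_sq -!sqr_nrm.
have H1 := dot_le u v; have H2 := dot_le u (fun j => -1 * v j + 0 * v j).
rewrite dotC dot_lin {1 2}dotC in H2.
have nv : nrm (fun j => -1 * v j + 0 * v j) = nrm v.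
  by congr Num.sqrt; rewrite dot_sq; ring.
rewrite nv in H2.
have H : a * b * dot u v <= `|a| * `|b| * (nrm u * nrm v).
  apply: le_trans (ler_norm _) _; rewrite !normrM; apply: ler_wpM2l.
    by rewrite mulr_ge0.
  by rewrite ler_norml; apply/andP; split; lra.
have := real_normK (num_real a); have := real_normK (num_real b) => <- <-.
rewrite sqrrD !exprMn; nra.
Qed.

Lemma eq_nrm u v : u =1 v -> nrm u = nrm v.
Proof. by move=> e; congr Num.sqrt; apply: eq_bigr => j _; rewrite e. Qed.

Lemma distC x y : dist x y = dist y x.
Proof. by congr Num.sqrt; apply: eq_bigr => j _; ring. Qed.

Lemma dist_ge0 x y : 0 <= dist x y.
Proof. exact: nrm_ge0. Qed.

Lemma dist_triangle x y w : dist x w <= dist x y + dist y w.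
Proof.
have := nrm_lin_le 1 1 (fun j => x j - y j) (fun j => y j - w j).
rewrite !normr1 !mul1r; apply: le_trans; rewrite le_eqVlt; apply/orP; left; apply/eqP.
by apply: eq_nrm => j; ring.
Qed.

(** Norm 0 does not make [v] the zero function, since values from [d] on are arbitrary; two triangle
    inequalities replace the rewriting. *)
Lemma dist_nrm0 v x : nrm v = 0 -> dist v x = nrm x.
Proof.
move=> b0; apply/eqP; rewrite eq_le; apply/andP; split.
  have := nrm_lin_le 1 (-1) v x; rewrite b0 normrN !normr1 !mul1r add0r.
  by apply: le_trans; rewrite le_eqVlt; apply/orP; left; apply/eqP/eq_nrm => j; ring.
have := nrm_lin_le (-1) 1 (fun j => v j - x j) v.
rewrite b0 normrN !normr1 !mul1r addr0.
by apply: le_trans; rewrite le_eqVlt; apply/orP; left; apply/eqP/eq_nrm => j; ring.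
Qed.

(* The inversion centred at 0 sends u, v to points at distance
   |u - v| / (|u| |v|), and Ptolemy's inequality is the triangle inequality for
   the inverted points; the denominators are cleared. *)
Lemma ptolemy0 u v w :
  nrm w * dist u v <= nrm v * dist u w + nrm u * dist v w.
Proof.
have inv s t r : nrm (fun j => nrm t ^+ 2 * nrm r ^+ 2 * s j +
      - (nrm s ^+ 2 * nrm r ^+ 2) * t j)
    = nrm s * nrm t * nrm r ^+ 2 * dist s t.
  have -> : dist s t = nrm (fun j => 1 * s j + -1 * t j).
    by apply: eq_nrm => j; ring.
  apply/eqP; rewrite -(@eqrXn2 _ 2) ?nrm_ge0 ?mulr_ge0 ?exprn_ge0 ?nrm_ge0 //.
  rewrite !exprMn !sqr_nrm !dot_sq -!sqr_nrm; apply/eqP; ring.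
have [a0|a0] := eqVneq (nrm u) 0.
  by rewrite !(dist_nrm0 _ a0) a0 mul0r addr0 mulrC.
have [b0|b0] := eqVneq (nrm v) 0.
  by rewrite b0 mul0r add0r distC !(dist_nrm0 _ b0) mulrC.
have [c0|c0] := eqVneq (nrm w) 0.
  by rewrite c0 mul0r addr_ge0 // mulr_ge0 ?nrm_ge0.
have abc : 0 < nrm u * nrm v * nrm w by rewrite lt_neqAle eq_sym !mulf_neq0 //= !mulr_ge0 ?nrm_ge0.
rewrite -(ler_pM2l abc).
have := nrm_lin_le 1 1 (fun j => nrm w ^+ 2 * nrm v ^+ 2 * u j +
      - (nrm u ^+ 2 * nrm v ^+ 2) * w j) (fun j => nrm v ^+ 2 * nrm u ^+ 2 * w j +
      - (nrm w ^+ 2 * nrm u ^+ 2) * v j).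
rewrite !inv !normr1 !mul1r (distC w v) => H.
have : nrm u * nrm v * nrm w ^+ 2 * dist u v <= nrm u * nrm w * nrm v ^+ 2 * dist u w +
    nrm w * nrm v * nrm u ^+ 2 * dist v w.
  apply: le_trans H; rewrite -inv le_eqVlt; apply/orP; left; apply/eqP.
  by apply: eq_nrm => j; ring.
by move=> {}H; lra.
Qed.

Lemma dist_shift o x y : dist (fun j => x j - o j) (fun j => y j - o j) = dist x y.
Proof. by apply: eq_nrm => j; ring. Qed.

Lemma ptolemy o x y w :
  dist w o * dist x y <= dist y o * dist x w + dist x o * dist y w.
Proof.
have := ptolemy0 (fun j => x j - o j) (fun j => y j - o j) (fun j => w j - o j).
by rewrite !dist_shift.
Qed.

(* Twice the distance from [o] to the midpoint of [x] and [y]. *)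
Definition off_mid x y o := dist (fun j => o j + o j) (fun j => x j + y j).

Lemma off_mid_parallelogram x y o :
  off_mid x y o ^+ 2 + dist x y ^+ 2 = 2 * dist x o ^+ 2 + 2 * dist y o ^+ 2.
Proof.
have -> : off_mid x y o = nrm (fun j => 1 * (x j - o j) + 1 * (y j - o j)).
  rewrite /off_mid distC; apply: eq_nrm => j; ring.
have -> : dist x y = nrm (fun j => 1 * (x j - o j) + -1 * (y j - o j)).
  by apply: eq_nrm => j; ring.
by rewrite !sqr_nrm !dot_sq; ring.
Qed.

(* Ptolemy's inequality for o, x, p, y; the parallelogram identity bounds
   |x - y| / |y - o| by sqrt (4 - (4/5)^2) < 11/6. *)
Lemma far_from_midpoint p o x y : dist x o <= dist y o ->
  4 / 5 * dist x o <= off_mid x y o ->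
  dist p x <= 11 / 6 * dist p o + dist p y.
Proof.
move=> xy far; have := dist_ge0 x o; have := dist_ge0 y o; have := dist_ge0 p y.
have := dist_ge0 p o; move=> po py yo xo.
have [c0|c0] := eqVneq (dist y o) 0.
  have xo0 : dist x o = 0 by apply/eqP; rewrite eq_le xo -c0 xy.
  have := dist_triangle p o x; rewrite (distC o x) xo0; lra.
have cp : 0 < dist y o by rewrite lt_neqAle eq_sym c0.
have xy2 : dist x y <= 11 / 6 * dist y o.
  apply: nrm_le; first by lra.
  rewrite -sqr_nrm -/(dist x y); have := off_mid_parallelogram x y o.
  have : (4 / 5 * dist x o) ^+ 2 <= off_mid x y o ^+ 2.
    by rewrite ler_pXn2r ?nnegrE //; [lra|exact: dist_ge0].
  have : dist x o ^+ 2 <= dist y o ^+ 2 by rewrite ler_pXn2r ?nnegrE //.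
  rewrite !exprMn; have := sqr_ge0 (dist y o); lra.
rewrite -(ler_pM2l cp); apply: le_trans (ptolemy o p x y) _.
have : dist x o * dist p y <= dist y o * dist p y by apply: ler_wpM2r.
have : dist p o * dist x y <= dist p o * (11 / 6 * dist y o) by apply: ler_wpM2l.
lra.
Qed.

(** Passing through the midpoint, 2 |f - o| <= 8/5 |x - o|, so |f - o| <= 4/5 |c - o| <= 4/5 (|p -
    o| + |p - c|). The resulting coefficients 9/5 and 4/5 are below 11/6 and 1. The threshold 4/5 is
    chosen so that both 1 + 4/5 and sqrt (4 - (4/5)^2) stay below 11/6. *)
Lemma near_midpoint p o x y f c : off_mid x y o <= 4 / 5 * dist x o ->
  off_mid x y f <= off_mid x y o -> dist x o <= dist c o ->
  dist p f <= 11 / 6 * dist p o + dist p c.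
Proof.
move=> no fo xc.
have fo2 : 2 * dist f o <= off_mid x y f + off_mid x y o.
  have := dist_triangle (fun j => f j + f j) (fun j => x j + y j) (fun j => o j + o j).
  rewrite (distC (fun j => x j + y j)); apply: le_trans.
  rewrite le_eqVlt; apply/orP; left; apply/eqP.
  have -> : dist (fun j => f j + f j) (fun j => o j + o j) =
      nrm (fun j => 2 * (f j - o j) + 0 * o j) by apply: eq_nrm => j; ring.
  apply: (@pexpIrn _ 2); rewrite ?nnegrE ?nrm_ge0 ?mulr_ge0 ?dist_ge0 //.
  by rewrite exprMn !sqr_nrm dot_sq; ring.
have := dist_triangle p o f; have := dist_triangle c p o.
rewrite (distC c p) (distC o f); have := dist_ge0 p o; have := dist_ge0 p c; lra.
Qed.

End Geometry.

(** * Convexity of powers *)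

Section PowerMean.
Variable R : realType.

(** Jensen's inequality with weights [u], [v]. The induction step is Chebyshev's observation that
    a^(z+1) - b^(z+1) and a - b have the same sign. *)
Lemma power_mean (u v a b : R) z : 0 <= u -> 0 <= v -> 0 <= a -> 0 <= b ->
  (u * a + v * b) ^+ z.+1 <= (u + v) ^+ z * (u * a ^+ z.+1 + v * b ^+ z.+1).
Proof.
move=> u0 v0 a0 b0; elim: z => [|z IH]; first by rewrite !expr1 expr0 mul1r.
rewrite exprS; apply: le_trans (ler_wpM2l _ IH) _.
  by rewrite addr_ge0 // mulr_ge0.
rewrite [X in _ <= X * _]exprS mulrCA -!mulrA.
rewrite [X in _ <= X]mulrCA; apply: ler_wpM2l; first by rewrite exprn_ge0 // addr_ge0.
rewrite !(exprS _ z.+1).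
have : 0 <= u * v * ((a ^+ z.+1 - b ^+ z.+1) * (a - b)).
  apply: mulr_ge0; first exact: mulr_ge0.
  have [ab|/ltW ba] := lerP a b.
    by apply: mulr_le0; rewrite subr_le0 // lerXn2r.
  by apply: mulr_ge0; rewrite subr_ge0 // lerXn2r.
set A := a ^+ z.+1; set B := b ^+ z.+1; lra.
Qed.

End PowerMean.


(** * The greedy bicriteria solution *)

Section Greedy.
Variables (R : realType) (n F m : nat) (inc : nat -> nat -> bool).
Variable C : nat -> nat -> R.
Hypothesis C_ge0 : forall p x, 0 <= C p x.
Implicit Types (phi psi : nat -> R) (g : R) (L : seq nat).

Definition relax phi x := fun p => Num.min (phi p) (C p x).
Definition relaxs (B : R) L := foldl relax (fun=> B) L.
Definition gsum phi i := \sum_(0 <= p < n | inc i p) phi p.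
Definition excess g phi i := Num.max 0 (gsum phi i - g).
Definition pot g phi := \sum_(0 <= i < m) excess g phi i.
Definition maxsum phi := \big[Num.max/0]_(0 <= i < m) gsum phi i.

Lemma gsum_le phi psi i :
  (forall p, (p < n)%N -> phi p <= psi p) -> gsum phi i <= gsum psi i.
Proof.
by move=> le; rewrite /gsum !big_mkord; apply: ler_sum => p _; exact: le.
Qed.

Lemma eq_gsum phi psi i :
  (forall p, (p < n)%N -> phi p = psi p) -> gsum phi i = gsum psi i.
Proof.
by move=> e; apply/eqP; rewrite eq_le !gsum_le // => p /e ->.
Qed.

Lemma eq_pot g phi psi :
  (forall p, (p < n)%N -> phi p = psi p) -> pot g phi = pot g psi.
Proof. by move=> e; apply: eq_bigr => i _; rewrite /excess (eq_gsum _ e). Qed.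

Lemma eq_maxsum phi psi :
  (forall p, (p < n)%N -> phi p = psi p) -> maxsum phi = maxsum psi.
Proof. by move=> e; apply: eq_bigr => i _; rewrite (eq_gsum _ e). Qed.

Lemma le_gsum phi i p : (forall p, 0 <= phi p) -> (p < n)%N -> inc i p ->
  phi p <= gsum phi i.
Proof.
move=> p0 pn ip; rewrite /gsum big_mkord (bigD1 (Ordinal pn)) //=.
by rewrite lerDl sumr_ge0.
Qed.

Lemma gsum_le_maxsum phi i : (i < m)%N -> gsum phi i <= maxsum phi.
Proof. by move=> im; rewrite /maxsum big_mkord (le_bigmax _ _ (Ordinal im)). Qed.

Lemma maxsum_le phi c : 0 <= c -> (forall i, (i < m)%N -> gsum phi i <= c) ->
  maxsum phi <= c.
Proof. by move=> c0 le; rewrite /maxsum big_mkord; apply: bigmax_le => // i _; exact: le. Qed.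

Lemma maxsum_ge0 phi : 0 <= maxsum phi.
Proof. by rewrite /maxsum; elim/big_rec: _ => // i x _ x0; rewrite le_max x0 orbT. Qed.

Lemma relax_le phi x p : relax phi x p <= phi p.
Proof. by rewrite /relax ge_min lexx. Qed.

Lemma relax_ge0 phi x : (forall p, 0 <= phi p) -> forall p, 0 <= relax phi x p.
Proof. by move=> p0 p; rewrite /relax le_min p0 C_ge0. Qed.

Lemma relaxs_rcons B L x : relaxs B (rcons L x) = relax (relaxs B L) x.
Proof. by rewrite /relaxs foldl_rcons. Qed.

Lemma relaxs_ge0 B L : 0 <= B -> forall p, 0 <= relaxs B L p.
Proof.
move=> B0; elim/last_ind: L => // L x IH p.
by rewrite relaxs_rcons; apply: relax_ge0.
Qed.

Lemma relaxs_le B L x p : x \in L -> relaxs B L p <= C p x.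
Proof.
elim/last_ind: L => // L y IH; rewrite mem_rcons inE relaxs_rcons /relax ge_min.
by move=> /orP[/eqP ->|/IH ->//]; rewrite lexx orbT.
Qed.

Lemma relaxs_attained B L p :
  relaxs B L p = B \/ exists2 x, x \in L & relaxs B L p = C p x.
Proof.
elim/last_ind: L => [|L y IH]; first by left.
rewrite relaxs_rcons /relax minEle; case: ifP => _; last first.
  by right; exists y; rewrite ?mem_rcons ?mem_head.
by case: IH => [->|[x xL ->]]; [left|right; exists x; rewrite ?mem_rcons ?inE ?xL ?orbT].
Qed.

Lemma excess_ge0 g phi i : 0 <= excess g phi i.
Proof. by rewrite /excess le_max lexx. Qed.

Lemma excess_relax_le g phi x i : excess g (relax phi x) i <= excess g phi i.
Proof.
rewrite /excess ge_max le_max lexx /= le_max lerD2r gsum_le ?orbT // => p _.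
exact: relax_le.
Qed.

(* Supermodularity of the truncated cost of one group: the centers of a solution
   of cost at most [g] together remove the whole excess. *)
Lemma excess_drop g phi psi (Xs : seq nat) i : gsum psi i <= g ->
  (forall p, (p < n)%N -> exists2 x, x \in Xs & C p x <= psi p) ->
  excess g phi i <= \sum_(x <- Xs) (excess g phi i - excess g (relax phi x) i).
Proof.
move=> psig cov.
have t0 x : 0 <= excess g phi i - excess g (relax phi x) i.
  by rewrite subr_ge0 excess_relax_le.
have [phig|phig] := lerP (gsum phi i) g.
  rewrite {1}/excess max_l ?subr_le0 //; exact: sumr_ge0.
have [/hasP[x xX xg]|/hasPn noX] := boolP (has (fun x => gsum (relax phi x) i <= g) Xs).
  rewrite (big_rem x) //= {3}/excess [Num.max 0 (gsum (relax _ _) _ - _)]max_l ?subr_le0 //.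
  by rewrite subr0 lerDl sumr_ge0.
rewrite big_seq (eq_bigr (fun x => \sum_(0 <= p < n | inc i p) (phi p - relax phi x p))); last first.
  move=> x /noX; rewrite -ltNge => xg.
  by rewrite /excess !max_r ?subr_ge0 ?ltW // sumrB -/(gsum phi i) -/(gsum (relax phi x) i); ring.
rewrite -big_seq exchange_big /= /excess max_r ?subr_ge0 ?(ltW phig) //.
apply: (@le_trans _ _ (gsum phi i - gsum psi i)); first by lra.
rewrite -sumrB [leLHS]big_nat_cond [leRHS]big_nat_cond.
apply: ler_sum => p /andP[/andP[_ pn] _].
have d0 x : 0 <= phi p - relax phi x p by rewrite subr_ge0 relax_le.
have [x xX xp] := cov _ pn.
rewrite (big_rem x) //=; apply: ler_wpDr; first exact: sumr_ge0.
by rewrite lerD2l lerN2 /relax ge_min xp orbT.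
Qed.

(** If [Xs] has k elements, at least one of the k terms on the right is a k-th of the potential or
    more; this drives the greedy choice. *)
Lemma pot_drop g phi psi (Xs : seq nat) :
  (forall i, (i < m)%N -> gsum psi i <= g) ->
  (forall p, (p < n)%N -> exists2 x, x \in Xs & C p x <= psi p) ->
  pot g phi <= \sum_(x <- Xs) (pot g phi - pot g (relax phi x)).
Proof.
move=> psig cov; rewrite (eq_bigr (fun x => \sum_(0 <= i < m)
   (excess g phi i - excess g (relax phi x) i))); last by move=> x _; rewrite sumrB.
rewrite exchange_big /= /pot [leLHS]big_nat [leRHS]big_nat; apply: ler_sum => i /andP[_ im].
by apply: excess_drop cov; exact: psig.
Qed.

(** A relation leaves ties open, so the program only has to return some minimiser in each step. *)
Inductive greedy g (B : R) : seq nat -> Prop :=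
  | greedy_nil : greedy g B [::]
  | greedy_rcons L y : greedy g B L -> (y < F)%N ->
      (forall x, (x < F)%N ->
         pot g (relaxs B (rcons L y)) <= pot g (relaxs B (rcons L x))) ->
      greedy g B (rcons L y).

Lemma greedy_lt g B L x : greedy g B L -> x \in L -> (x < F)%N.
Proof.
elim=> // {}L y _ IH yF _; rewrite mem_rcons inE => /orP[/eqP -> //|]; exact: IH.
Qed.

Lemma pot_ge0 g phi : 0 <= pot g phi.
Proof. by apply: sumr_ge0 => i _; exact: excess_ge0. Qed.

Lemma greedy_pot g B psi (Xs : seq nat) L :
  (forall i, (i < m)%N -> gsum psi i <= g) -> all (fun x => (x < F)%N) Xs ->
  (forall p, (p < n)%N -> exists2 x, x \in Xs & C p x <= psi p) ->
  greedy g B L ->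
  (size Xs)%:R ^+ size L * pot g (relaxs B L)
    <= ((size Xs)%:R - 1) ^+ size L * pot g (fun=> B).
Proof.
move=> psig XF cov.
have [Xs0|Xs_gt0] := posnP (size Xs).
  rewrite Xs0 => _; have n0 : n = 0%N.
    case: (n) (cov) => // n' /(_ 0%N isT) [x]; by rewrite (size0nil Xs0).
  have p0 f : pot g f <= 0.
    apply: le_trans (pot_drop _ psig cov) _.
    by rewrite (size0nil Xs0) big_nil.
  have {}p0 f : pot g f = 0 by apply/eqP; rewrite eq_le p0 pot_ge0.
  by rewrite !p0 !mulr0.
elim=> [|{}L y gL IH yF ymin]; first by rewrite !expr0 !mul1r.
rewrite size_rcons !exprS.
have K0 : 1 <= (size Xs)%:R :> R by rewrite ler1n.
apply: (@le_trans _ _ (((size Xs)%:R - 1) *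
    ((size Xs)%:R ^+ size L * pot g (relaxs B L)))); last first.
  by rewrite -[leRHS]mulrA ler_wpM2l // subr_ge0.
rewrite -mulrA !(mulrCA _ ((size Xs)%:R ^+ _)) ler_wpM2l ?exprn_ge0 //.
have := pot_drop (relaxs B L) psig cov => H.
have : pot g (relaxs B L) <=
    \sum_(x <- Xs) (pot g (relaxs B L) - pot g (relaxs B (rcons L y))).
  apply: le_trans H _; rewrite [leLHS]big_seq [leRHS]big_seq; apply: ler_sum => x xX.
  by rewrite lerD2l lerN2 -relaxs_rcons ymin // (allP XF).
rewrite big_const_seq count_predT iter_addr addr0 -mulr_natl; lra.
Qed.

(** Since (1 - 1/k)^k <= 1/2, each block of k greedy steps halves the potential. Denominators are
    cleared throughout. *)
Lemma halving (k l : nat) (a b : R) : (0 < k)%N -> 0 <= a -> 0 <= b ->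
  k%:R ^+ (k * l) * a <= (k%:R - 1) ^+ (k * l) * b -> 2 ^+ l * a <= b.
Proof.
move=> k0 a0 b0; have K0 : 0 < k%:R :> R by rewrite ltr0n.
have B : 2 * (k%:R - 1) ^+ k <= k%:R ^+ k :> R.
  case: k k0 {K0} => // k _; rewrite -[k.+1%:R]natr1 addrK.
  have [->|k0] := posnP k; first by rewrite !expr1 !add0r mulr0.
  have K0 : 0 < k%:R :> R by rewrite ltr0n.
  (* Bernoulli's inequality (1 + 1/k)^j >= 1 + j/k, needed for j = k + 1; here [k] is already the
     predecessor of the original one. *)
  have H (j : nat) : k%:R ^+ j * (k%:R + j%:R) <= (k%:R + 1) ^+ j * k%:R :> R.
    elim: j => [|j IH]; first by rewrite !expr0 addr0.
    rewrite !exprS -!mulrA; apply: (@le_trans _ _ ((k%:R + 1) * (k%:R ^+ j * (k%:R + j%:R))));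
      last by rewrite ler_wpM2l // addr_ge0.
    rewrite [leRHS]mulrCA [leLHS]mulrCA ler_wpM2l ?exprn_ge0 ?(ltW K0) //.
    have := ler0n R j; have := K0; rewrite -[j.+1%:R]natr1; nra.
  rewrite -(ler_pM2r K0); apply: le_trans (H k.+1).
  rewrite mulrAC -mulrA [leLHS]mulrC -mulrA mulrC.
  have e0 : 0 <= k%:R ^+ k.+1 :> R by rewrite exprn_ge0.
  rewrite -[k.+1%:R]natr1; nra.
rewrite !exprM => H.
have E : (2 * (k%:R - 1) ^+ k) ^+ l <= (k%:R ^+ k) ^+ l :> R.
  apply: lerXn2r => //; rewrite nnegrE; last by rewrite exprn_ge0.
  by rewrite mulr_ge0 // exprn_ge0 // subr_ge0 ler1n.
have P : 0 < (k%:R ^+ k) ^+ l :> R by rewrite !exprn_gt0.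
rewrite -(ler_pM2l P) mulrCA.
apply: (@le_trans _ _ (2 ^+ l * (((k%:R - 1) ^+ k) ^+ l * b))).
  by rewrite ler_wpM2l // exprn_ge0.
by rewrite mulrA -exprMn ler_wpM2r.
Qed.

Hypothesis cover : forall p, (p < n)%N -> exists2 i, (i < m)%N & inc i p.

(** The initial potential is at most 2gmn, and [l] halvings with 2^l >= 32mn leave at most g/16.
    Hence each group costs at most 17/16 g < 2g, so no point can still have the truncation value
    2g. *)
Lemma greedy_cover g psi (Xs : seq nat) l L : 0 < g ->
  (forall i, (i < m)%N -> gsum psi i <= g) -> all (fun x => (x < F)%N) Xs ->
  (forall p, (p < n)%N -> exists2 x, x \in Xs & C p x <= psi p) ->
  (0 < size Xs)%N -> (32 * (m * n) <= 2 ^ l)%N -> size L = (size Xs * l)%N ->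
  greedy g (g + g) L ->
  (forall i, (i < m)%N -> gsum (relaxs (g + g) L) i <= 17 / 16 * g) /\
  forall p, (p < n)%N -> exists2 x, x \in L & relaxs (g + g) L p = C p x.
Proof.
move=> g0 psig XF cov X0 ml sL gr.
have := greedy_pot psig XF cov gr; rewrite sL.
move=> /(halving X0 (pot_ge0 _ _) (pot_ge0 _ _)) H.
have P0 : pot g (fun=> g + g) <= (m * n)%:R * (g + g).
  apply: (@le_trans _ _ (\sum_(0 <= i < m) n%:R * (g + g))).
    apply: ler_sum => i _; rewrite /excess ge_max mulr_ge0 ?addr_ge0 ?(ltW g0) //=.
    apply: (@le_trans _ _ (gsum (fun=> g + g) i)); first by lra.
    rewrite /gsum big_mkord.
    apply: (@le_trans _ _ (\sum_(p < n) (g + g))).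
      rewrite big_mkcond; apply: ler_sum => p _; case: ifP => _; lra.
    by rewrite sumr_const card_ord mulr_natl.
  by rewrite sumr_const_nat subn0 -[leLHS]mulr_natl natrM mulrA.
have small : pot g (relaxs (g + g) L) <= g / 16.
  have L0 : 0 < 2 ^+ l :> R by rewrite exprn_gt0.
  rewrite -(ler_pM2l L0); apply: le_trans H _; apply: le_trans P0 _.
  move: ml; rewrite -(ler_nat R) natrM natrX; nra.
have gs i : (i < m)%N -> gsum (relaxs (g + g) L) i <= 17 / 16 * g.
  move=> im; have : excess g (relaxs (g + g) L) i <= pot g (relaxs (g + g) L).
    rewrite /pot big_mkord (bigD1 (Ordinal im)) //= lerDl sumr_ge0 // => j _.
    exact: excess_ge0.
  have : gsum (relaxs (g + g) L) i - g <= excess g (relaxs (g + g) L) i.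
    by rewrite /excess le_max lexx orbT.
  lra.
split=> // p pn; have [i im ip] := cover pn.
have := le_gsum (relaxs_ge0 L (_ : 0 <= g + g)) pn ip.
move=> /(_ (addr_ge0 (ltW g0) (ltW g0))) h1; have h2 := gs _ im.
case: (relaxs_attained (g + g) L p) => [E|//]; rewrite E in h1; lra.
Qed.

(* If the optimum is positive, the guess is a multiple of 1/16 of its largest
   single connection cost [r], because r <= O <= n r.  If the optimum is 0, a
   sixteenth of the least positive connection cost serves: a cover of cost less
   than that connection cost has cost 0. *)
Lemma guess_cover (O : R) (op : nat -> nat) (Xs : seq nat) l (N : nat) (CT : nat -> R) :
  (forall p, (p < n)%N -> op p \in Xs) ->
  (forall i, (i < m)%N -> gsum (fun p => C p (op p)) i <= O) -> 0 <= O ->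
  all (fun x => (x < F)%N) Xs -> (0 < size Xs)%N -> (32 * (m * n) <= 2 ^ l)%N ->
  (0 < l)%N -> (0 < N)%N ->
  (forall p x, (p < n)%N -> (x < F)%N -> exists2 idx, (idx < N)%N & CT idx = C p x) ->
  exists idx j : nat, [/\ (idx < N)%N, (j <= 16 * n)%N &
    let g := CT idx * j%:R / 16 in
    forall L, greedy g (g + g) L -> size L = (size Xs * l)%N ->
    exists2 psi : nat -> R, (forall i, (i < m)%N -> gsum psi i <= (17 / 16) ^+ 2 * O) &
      forall p, (p < n)%N -> exists2 x, x \in L & C p x <= psi p].
Proof.
move=> opX opO O0 XF X0 ml l0 N0 CTP.
set ps := fun p => C p (op p).
have cov p : (p < n)%N -> exists2 x, x \in Xs & C p x <= ps p.
  by move=> pn; exists (op p); [exact: opX|].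
have ps0 p : 0 <= ps p by exact: C_ge0.
have [/existsP[p1 p1_gt0]|] := boolP [exists p : 'I_n, 0 < ps p].
  have [p0 _ p0max] := arg_maxP (fun p : 'I_n => ps p) (isT : xpredT p1).
  have {p1 p1_gt0}p0_gt0 : 0 < ps p0 by apply: lt_le_trans p1_gt0 (p0max _ _).
  have [i0 i0m i0p] := cover (ltn_ord p0).
  set r := ps p0 in p0max p0_gt0.
  have rO : r <= maxsum ps.
    by apply: le_trans (gsum_le_maxsum _ i0m); exact: le_gsum.
  have mO : maxsum ps <= O by apply: maxsum_le.
  have m16 : maxsum ps <= r * (16 * n)%N%:R / 16.
    rewrite natrM; apply: maxsum_le; first by rewrite !mulr_ge0 ?invr_ge0 // ltW.
    move=> i im; apply: (@le_trans _ _ (\sum_(p < n) r)).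
      rewrite /gsum big_mkord big_mkcond; apply: ler_sum => p _.
      by case: ifP => _; [exact: p0max|exact: ltW].
    rewrite sumr_const card_ord -mulr_natl; lra.
  have ex : exists j : nat, maxsum ps <= r * j%:R / 16 by exists (16 * n)%N.
  have jn : (ex_minn ex <= 16 * n)%N by case: ex_minnP => j _; apply.
  have [idx iN iC] := CTP _ _ (ltn_ord p0) (allP XF _ (opX _ (ltn_ord p0))).
  exists idx, (ex_minn ex); split=> //; rewrite iC -/(ps p0) -/r.
  case: ex_minnP => -[|j] jP jmin g L gr sL.
    by have : maxsum ps <= 0 by [rewrite mulr0 mul0r in jP]; lra.
  have g0 : 0 < g by rewrite /g; apply: lt_le_trans jP; apply: lt_le_trans rO.
  (* By minimality of the multiplier, g - r/16 is below the largest group cost, which itself is at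
     least r. *)
  have gO : g <= 17 / 16 * O.
    have : r * j%:R / 16 < maxsum ps by rewrite ltNge; apply/negP => /jmin; rewrite ltnn.
    rewrite /g -[j.+1%:R]natr1; lra.
  have psg i : (i < m)%N -> gsum ps i <= g.
    by move=> im; apply: le_trans jP; apply: gsum_le_maxsum.
  have [gs at_] := greedy_cover g0 psg XF cov X0 ml sL gr.
  exists (relaxs (g + g) L) => [i im|p pn]; first by have := gs _ im; lra.
  by have [x xL ->] := at_ _ pn; exists x.
rewrite negb_exists => /forallP nops.
have psE p : (p < n)%N -> ps p = 0.
  by move=> pn; apply/eqP; rewrite eq_le ps0 andbT leNgt (nops (Ordinal pn)).
have psg i : gsum ps i <= 0.
  rewrite /gsum big_nat_cond big1 // => p /andP[/andP[_ pn] _]; exact: psE.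
have OO : 0 <= (17 / 16) ^+ 2 * O by rewrite mulr_ge0 // exprn_ge0 ?divr_ge0.
have gs0 i : gsum (fun=> 0) i <= (17 / 16) ^+ 2 * O by rewrite /gsum big1.
have [/existsP[q1 q1_gt0]|] := boolP [exists q : 'I_n * 'I_F, 0 < C q.1 q.2].
  have [q q_gt0 qmin] := @arg_minP _ _ _ q1 (fun q => 0 < C q.1 q.2) (fun q => C q.1 q.2) q1_gt0.
  have [idx iN iC] := CTP _ _ (ltn_ord q.1) (ltn_ord q.2).
  exists idx, 1%N; split=> //; first by have := ltn_ord q.1; lia.
  rewrite iC mulr1 => g L gr sL.
  have g0 : 0 < g by rewrite /g divr_gt0.
  have psg' i : (i < m)%N -> gsum ps i <= g by move=> _; apply: le_trans (ltW g0).
  have [gs at_] := greedy_cover g0 psg' XF cov X0 ml sL gr.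
  exists (fun=> 0) => // p pn; have [x xL xE] := at_ _ pn; exists x => //.
  have [i im ip] := cover pn.
  have := le_gsum (relaxs_ge0 L (addr_ge0 (ltW g0) (ltW g0))) pn ip.
  have := gs _ im; rewrite xE => h1 h2; rewrite leNgt; apply/negP => x0.
  have := qmin (Ordinal pn, Ordinal (greedy_lt gr xL)) x0; rewrite /= /g in h1 h2 *; lra.
rewrite negb_exists => /forallP noC.
(* All connection costs vanish, so the first element of [L] serves every point; [L] is nonempty
   because its length is a product of positive numbers. *)
exists 0%N, 0%N; split=> // g L gr sL.
exists (fun=> 0) => // p pn; case: L gr sL => [|x L] gr sL.
  by move: sL => /esym/eqP; rewrite /= muln_eq0; lia.
exists x; rewrite ?mem_head //.
have xF := greedy_lt gr (mem_head x L).
by rewrite leNgt (noC (Ordinal pn, Ordinal xF)).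
Qed.

End Greedy.


(** * The program *)

Notation "p ;; q" := (PSeq p q) (at level 60, right associativity).
Notation "a ::=N e" := (PSetN a Z0 e) (at level 55).
Notation "a ::=R e" := (PSetR a Z0 e) (at level 55).
Notation nN := (NGet 0 (NConst 0)).
Notation nF := (NGet 0 (NConst 1)).
Notation nM := (NGet 0 (NConst 2)).
Notation nD := (NGet 0 (NConst 3)).
Notation nK := (NGet 0 (NConst 4)).
Notation N1 := (NConst 1).

(* Memory layout, besides the input and output arrays.
   Integer arrays: 3 number of multiples of 1/16 to try, 4 bound for the
   logarithm, 5 number of entries of real array 3 to try, 6 length T of the
   greedy list, 7 T^2, 8 number (T^2)^k of tuples, 9 offsets x d of the
   facilities, 10 greedy list, 11 candidate list, 12 current selection,
   13 running address, 14 facility argument, 15 result of a minimisation,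
   16 and 17 remainder and quotient, 18 size of the selection, 19 whether the
   output has been set, 20 to 31 loop counters, 32 and 33 offsets.
   Real arrays: 3 weighted distances w(p) delta(p,x)^z, row by row, 4 and 5
   connection costs phi, 6 cost of a group, 7 potential, 8 largest group cost,
   9 guess of the optimum, 10 sum of array 3, 11 running minimum, 12 value of
   the output, 13 to 15 scratch. *)
Definition pTry : prog :=
  13 ::=N VN 14 ;;
  PFor 24 nN (
    PIf (BLeR (RGet 4 (VN 24)) (RGet 3 (VN 13)))
      (PSetR 5 (VN 24) (RGet 4 (VN 24)))
      (PSetR 5 (VN 24) (RGet 3 (VN 13))) ;;
    13 ::=N NAdd (VN 13) nF).

Definition pCommit : prog := PFor 24 nN (PSetR 4 (VN 24) (RGet 5 (VN 24))).

Definition pGroup : prog :=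
  PFor 24 nN (
    PIf (BLeN N1 (NGet 1 (VN 13)))
      (6 ::=R RAdd (VR 6) (RGet 5 (VN 24))) PSkip ;;
    13 ::=N NAdd (VN 13) N1).

(** One pass gives both the potential (cell 7), which the greedy steps minimise, and the largest
    group cost (cell 8), which compares tuples. *)
Definition pGroups : prog :=
  13 ::=N Z0 ;; 7 ::=R RNat Z0 ;; 8 ::=R RNat Z0 ;;
  PFor 25 nM (
    6 ::=R RNat Z0 ;; pGroup ;;
    PIf (BLeR (VR 8) (VR 6)) (8 ::=R VR 6) PSkip ;;
    PIf (BLeR (VR 9) (VR 6)) (7 ::=R RAdd (VR 7) (RSub (VR 6) (VR 9))) PSkip).

(** The argument is passed in integer cell 14 and the value returned in real cell [v]. The test on
    the counter accepts the first argument unconditionally, in place of an infinite initial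
    minimum. *)
Definition pArgmin (body : prog) (v : nat) : prog :=
  PFor 23 nF (
    14 ::=N VN 23 ;; body ;;
    PIf (BAnd (BLeN N1 (VN 23)) (BLeR (VR 11) (VR v))) PSkip
      (11 ::=R VR v ;; 15 ::=N VN 23)).

(** After the minimisation, real array 5 belongs to the last facility tried, so the winner is tried
    again before the commit. *)
Definition pStep : prog :=
  pArgmin (pTry ;; pGroups) 7 ;; 14 ::=N VN 15 ;; pTry ;; pCommit ;;
  PSetN 10 (VN 22) (VN 15).

Definition pGreedy : prog :=
  PFor 24 nN (PSetR 4 (VN 24) (RAdd (VR 9) (VR 9))) ;; PFor 22 (VN 6) pStep.

Definition pDD : prog :=
  13 ::=R RNat Z0 ;;
  PFor 26 nD (
    32 ::=N NGet 9 (NGet 10 (VN 27)) ;;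
    33 ::=N NGet 9 (NGet 10 (VN 28)) ;;
    14 ::=R RSub (RAdd (RGet 1 (NAdd (NGet 9 (VN 14)) (VN 26)))
                       (RGet 1 (NAdd (NGet 9 (VN 14)) (VN 26))))
                 (RAdd (RGet 1 (NAdd (VN 32) (VN 26))) (RGet 1 (NAdd (VN 33) (VN 26)))) ;;
    13 ::=R RAdd (VR 13) (RMul (VR 14) (VR 14))).

Definition pMidRow : prog :=
  PFor 28 (VN 6) (
    pArgmin pDD 13 ;; PSetN 11 (VN 13) (VN 15) ;; 13 ::=N NAdd (VN 13) N1).

Definition pMid : prog := 13 ::=N Z0 ;; PFor 27 (VN 6) pMidRow.

Fixpoint rpow (e : rexp) (z : nat) : rexp :=
  if z is z'.+1 then RMul e (rpow e z') else RNat N1.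

(** Row addresses x d are tabulated once, as integers cannot be multiplied. *)
Definition pOffsets : prog :=
  13 ::=N Z0 ;;
  PFor 23 nF (PSetN 9 (VN 23) (VN 13) ;; 13 ::=N NAdd (VN 13) nD).

Definition pSqDist : prog :=
  13 ::=R RNat Z0 ;;
  PFor 26 nD (
    14 ::=R RSub (RGet 0 (NAdd (VN 14) (VN 26))) (RGet 1 (NAdd (NGet 9 (VN 23)) (VN 26))) ;;
    13 ::=R RAdd (VR 13) (RMul (VR 14) (VR 14))).

(** The sum of the whole table, collected in real array 10, bounds each entry; it later replaces
    infinity as the connection cost before any center is picked. *)
Definition pTableRow (z : nat) : prog :=
  PFor 23 nF (
    pSqDist ;;
    15 ::=R RMul (RGet 2 (VN 24)) (rpow (RSqrt (VR 13)) z) ;;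
    PSetR 3 (VN 13) (VR 15) ;;
    10 ::=R RAdd (VR 10) (VR 15) ;;
    13 ::=N NAdd (VN 13) N1).

Definition pTable (z : nat) : prog :=
  pOffsets ;;
  13 ::=N Z0 ;; 14 ::=N Z0 ;; 10 ::=R RNat Z0 ;;
  PFor 24 nN (pTableRow z ;; 14 ::=N NAdd (VN 14) nD).

(** * Correctness of the cost table, the greedy list and the midpoint candidates *)

Section Specs.
Variable R : realType.
Implicit Types s : state R.
Variables (sz inc0 : nat -> nat) (ptA facA wA CT : nat -> R).
Local Notation n := (sz 0).
Local Notation F := (sz 1).
Local Notation m := (sz 2).
Local Notation d := (sz 3).
Local Notation k := (sz 4).
Local Notation Cf := (fun p x => CT (p * F + x)%N).
Local Notation incf := (fun i p => (0 < inc0 (i * n + p))%N).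

Lemma try_spec s : ints s 0 = sz -> reals s 3 = CT ->
  forall p, (p < n)%N ->
    reals (den pTry s) 5 p = relax Cf (reals s 4) (ints s 14 0) p.
Proof.
move=> s0 s3; rewrite /pTry !denE; set s1 := setN _ _ _ _; set s2 := den _ s1.
pose P j s' := ints s' 13 0 = (ints s 14 0 + j * F)%N /\ forall p, (p < j)%N ->
    reals s' 5 p = relax Cf (reals s 4) (ints s 14 0) p.
suff : P n s2 by case.
apply: for_invE => //.
- by rewrite /s1; simp; rewrite s0.
- by split=> //; rewrite /s1; simp; rewrite mul0n addn0.
move=> j s' jn ij [aN aR] [adr IH].
have e0 : ints s' 0 = sz := etrans (aN 0%N isT) s0.
have e3 : reals s' 3 = CT := etrans (aR 3 isT) s3.
have e4 : reals s' 4 = reals s 4 := aR 4 isT.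
rewrite !denE /=; case: ifP; rewrite e3 e4 adr ij => cmp;
  (split; [by simp; rewrite adr e0; lia|move=> p; simp; rewrite ltnS leq_eqVlt]);
  rewrite ?ij; case: eqVneq => [-> _|_ /= /IH //];
  by rewrite ?adr ?e3 ?e4 /relax minEle [(_ * _ + _)%N]addnC cmp.
Qed.

Lemma commit_spec s : ints s 0 = sz ->
  forall p, (p < n)%N -> reals (den pCommit s) 4 p = reals s 5 p.
Proof.
move=> s0; rewrite /pCommit.
apply: (@for_invE _ n _ _ _ _ (fun j s' => forall p, (p < j)%N -> reals s' 4 p = reals s 5 p)) => //.
  by rewrite /= s0.
move=> j s' jn ij [aN aR] IH p; rewrite !denE; simp; rewrite ij ltnS leq_eqVlt.
by case: eqVneq => [-> _|_ /= /IH //]; rewrite (aR 5 isT).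
Qed.

Lemma group_spec s i : ints s 0 = sz -> ints s 1 = inc0 ->
  ints s 13 0 = (i * n)%N -> reals s 6 0 = 0 ->
  reals (den pGroup s) 6 0 = gsum n incf (reals s 5) i /\
  ints (den pGroup s) 13 0 = (i.+1 * n)%N.
Proof.
move=> s0 s1 s13 s6; rewrite /pGroup.
have -> : (i.+1 * n = i * n + n)%N by lia.
rewrite /gsum big_mkcond.
apply: (@for_invE _ n _ _ _ _ (fun j s' => reals s' 6 0 =
    \sum_(0 <= p < j) (if incf i p then reals s 5 p else 0) /\ ints s' 13 0 = (i * n + j)%N)) => //.
- by rewrite /= s0.
- by rewrite big_geq //; simp; rewrite s6 s13 addn0.
move=> j s' jn ij [aN aR] [IH adr].
have e1 : ints s' 1 = inc0 := etrans (aN 1%N isT) s1.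
have e5 : reals s' 5 = reals s 5 := aR 5 isT.
rewrite big_nat_recr //= !denE /= e1 adr.
by case: ifP => _; simp; rewrite adr -?addnA ?addn1 ?IH ?e5 ?ij ?addr0.
Qed.

Lemma groups_spec s : ints s 0 = sz -> ints s 1 = inc0 ->
  let s' := den pGroups s in
  reals s' 7 0 = pot n m incf (reals s 9 0) (reals s 5) /\
  reals s' 8 0 = maxsum n m incf (reals s 5).
Proof.
move=> s0 s1; rewrite /pGroups !denE; set t1 := setR _ 8 _ _; set t2 := den _ t1.
pose P j s' := [/\ ints s' 13 0 = (j * n)%N,
  reals s' 7 0 = pot n j incf (reals s 9 0) (reals s 5), 0 <= reals s' 8 0,
  (forall i, (i < j)%N -> gsum n incf (reals s 5) i <= reals s' 8 0) &
  reals s' 8 0 = 0 \/ exists2 i, (i < j)%N & reals s' 8 0 = gsum n incf (reals s 5) i].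
suff : P m t2.
  case=> _ -> M0 Mge Mat; split=> //; apply/eqP; rewrite eq_le; apply/andP; split.
    by case: Mat => [->|[i im ->]]; [exact: maxsum_ge0|exact: gsum_le_maxsum].
  exact: maxsum_le.
apply: for_invE => //.
- by rewrite /t1; simp; rewrite s0.
- by rewrite /P /pot big_geq // /t1; simp; split=> //; left.
move=> j s' jn ij [aN aR] [adr IH M0 Mge Mat].
have e0 : ints s' 0 = sz := etrans (aN 0%N isT) s0.
have e1 : ints s' 1 = inc0 := etrans (aN 1%N isT) s1.
have e5 : reals s' 5 = reals s 5 := aR 5 isT.
have e9 : reals s' 9 = reals s 9 := aR 9 isT.
rewrite !denE; set u := setR s' _ _ _.
have [|gs ga] := @group_spec u j e0 e1 _ (erefl _); first by [].
have [bN bR] := den_agree pGroup u.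
have b7 : reals (den pGroup u) 7 = reals s' 7 := bR 7 isT.
have b8 : reals (den pGroup u) 8 = reals s' 8 := bR 8 isT.
have b9 : reals (den pGroup u) 9 = reals s 9 := etrans (bR 9 isT) e9.
have gE : gsum n incf (reals u 5) j = gsum n incf (reals s 5) j by rewrite -e5.
rewrite gE in gs; move: gs ga b7 b8 b9; set w := den pGroup u => gs ga b7 b8 b9.
rewrite /P /pot big_nat_recr //= -/(pot _ _ _ _ _) /excess /=.
have potE : forall x : R, x + (if reals s 9 0 <= gsum n incf (reals s 5) j
    then gsum n incf (reals s 5) j - reals s 9 0 else 0) =
    x + Num.max 0 (gsum n incf (reals s 5) j - reals s 9 0).
  by move=> x; congr (_ + _); case: lerP => c; [rewrite max_r ?subr_ge0|rewrite max_l ?subr_le0 ?ltW].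
rewrite -potE gs b8; case: (lerP (reals s' 8 0)) => cmp /=; simp; rewrite gs b9.
- have M0' : 0 <= gsum n incf (reals s 5) j by exact: le_trans cmp.
  have Mat' : gsum n incf (reals s 5) j = 0 \/ exists2 i, (i < j.+1)%N &
      gsum n incf (reals s 5) j = gsum n incf (reals s 5) i by right; exists j.
  have Mge' i : (i < j.+1)%N -> gsum n incf (reals s 5) i <= gsum n incf (reals s 5) j.
    by rewrite ltnS leq_eqVlt => /orP[/eqP -> //|/Mge /le_trans]; apply.
  by case: (lerP (reals s 9 0)) => cg /=; simp; rewrite ?b7 ?b9 ?gs ga IH ?addr0.
- have Mat' : reals s' 8 0 = 0 \/ exists2 i, (i < j.+1)%N & reals s' 8 0 = gsum n incf (reals s 5) i.
    by case: Mat => [->|[i im ->]]; [left|right; exists i => //; lia].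
  have Mge' i : (i < j.+1)%N -> gsum n incf (reals s 5) i <= reals s' 8 0.
    by rewrite ltnS leq_eqVlt => /orP[/eqP -> |/Mge //]; exact: ltW.
  by case: (lerP (reals s 9 0)) => cg /=; simp; rewrite ?b7 ?b8 ?b9 ?gs ga IH ?addr0.
Qed.

(** The value has to be right in every memory that agrees with the initial one on the unwritten
    arrays, which excludes dependence on leftovers of earlier rounds. *)
Lemma argmin_spec body v (f : nat -> R) s : ints s 0 = sz -> (0 < F)%N ->
  (15 \notin modN body)%N -> (23 \notin modN body)%N -> (0%N \notin modN body)%N ->
  (11 \notin modR body)%N ->
  (forall s', agree (modN (pArgmin body v)) (modR (pArgmin body v)) s s' ->
     (ints s' 14 0 < F)%N ->
     reals (den body s') v 0 = f (ints s' 14 0)) ->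
  let r := ints (den (pArgmin body v) s) 15 0 in
  (r < F)%N /\ forall x, (x < F)%N -> f r <= f x.
Proof.
move=> s0 F0 n15 n23 n0 n11 Hf; rewrite /pArgmin; set s2 := den _ s.
(* Before the first round, cells 11 and 15 hold leftovers, hence the premise. *)
pose P j s' := (0 < j)%N -> [/\ (ints s' 15 0 < j)%N, reals s' 11 0 = f (ints s' 15 0) &
  forall x, (x < j)%N -> f (ints s' 15 0) <= f x].
suff /(_ F0) [] : P F s2 by [].
apply: for_invE => //.
- by rewrite /= s0.
- by rewrite /= !inE /= mem_cat negb_or n23.
move=> j s' jn ij ag IH.
rewrite !denE; set u := setN s' _ _ _.
have u14 : ints u 14 0 = j by rewrite /u; simp.
have fE : reals (den body u) v 0 = f j.
  rewrite -u14; apply: Hf; rewrite ?u14 //.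
  by apply: (agree_trans ag); apply: agree_setN; rewrite !inE.
have [bN bR] := den_agree body u.
have b23 : ints (den body u) 23 0 = j by rewrite (bN _ n23).
have b15 : ints (den body u) 15 = ints s' 15 := bN _ n15.
have b11 : reals (den body u) 11 = reals s' 11 := bR _ n11.
rewrite /= fE b23 b11 => j0.
have := IH; rewrite /P; case: j jn ij u u14 fE bN bR b23 b15 b11 IH j0 => [|j] jn ij u u14 fE bN bR b23 b15 b11 IH j0.
  move=> _ /=; simp; rewrite ?fE ?b23; split=> //.
  by case.
move=> /(_ isT) [r1 r2 r3]; rewrite /= r2; case: (lerP (f _)) => cmp /=; simp.
  rewrite b15 b11; split=> //; first exact: ltnW.
  by move=> x; rewrite ltnS leq_eqVlt => /orP[/eqP -> //|/r3].
rewrite ?b23 ?fE; split=> // x; rewrite ltnS leq_eqVlt => /orP[/eqP -> //|/r3].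
by apply: le_trans; exact: ltW.
Qed.

Lemma step_spec s : ints s 0 = sz -> ints s 1 = inc0 -> reals s 3 = CT -> (0 < F)%N ->
  let s' := den pStep s in let y := ints s' 10 (ints s 22 0) in
  let P phi := pot n m incf (reals s 9 0) phi in
  [/\ (y < F)%N,
    (forall x, (x < F)%N -> P (relax Cf (reals s 4) y) <= P (relax Cf (reals s 4) x)),
    (forall p, (p < n)%N -> reals s' 4 p = relax Cf (reals s 4) y p) &
    forall t, t != ints s 22 0 -> ints s' 10 t = ints s 10 t].
Proof.
move=> s0 s1 s3 F0; rewrite /pStep !denE; set u := den (pArgmin _ _) s.
have [uN uR] := den_agree (pArgmin (pTry ;; pGroups) 7) s.
have [] := @argmin_spec (pTry ;; pGroups) 7
  (fun x => pot n m incf (reals s 9 0) (relax Cf (reals s 4) x)) s s0 F0 isT isT isT isT.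
  move=> s' [aN aR] s'F; rewrite denE.
  have [tN tR] := den_agree pTry s'.
  have t0 : ints (den pTry s') 0 = sz by rewrite (tN 0%N isT) (aN 0%N isT).
  have t1 : ints (den pTry s') 1 = inc0 by rewrite (tN 1%N isT) (aN 1%N isT).
  have [-> _] := groups_spec t0 t1.
  have -> : reals (den pTry s') 9 = reals s 9 by rewrite (tR 9 isT) (aR 9 isT).
  have -> := eq_pot m incf (reals s 9 0) (@try_spec s' (etrans (aN 0%N isT) s0) (etrans (aR 3 isT) s3)).
  by rewrite (aR 4 isT).
rewrite -/u => yF ymin; set v := setN u _ _ _; set w := den pTry v; set w' := den pCommit w.
have wN a : a \notin modN pCommit -> a \notin modN pTry -> ints w' a = ints v a.
  by move=> ac at_; rewrite /w' (den_ints pCommit) // (den_ints pTry).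
have w10 : ints w' 10 = ints s 10 := etrans (wN 10 isT isT) (uN 10 isT).
have w22 : ints w' 22 = ints s 22 := etrans (wN 22 isT isT) (uN 22 isT).
have w15 : ints w' 15 = ints u 15 := wN 15 isT isT.
rewrite /= w22 w15; simp; rewrite eqxx; split=> //.
- move=> p pn; rewrite commit_spec //; last first.
    exact: etrans (den_ints pTry v 0%N isT) (etrans (uN 0%N isT) s0).
  rewrite try_spec //.
  - by rewrite -(uR 4 isT).
  - exact: etrans (uN 0%N isT) s0.
  - exact: etrans (uR 3 isT) s3.
- by move=> t /negbTE ->; rewrite w10.
Qed.

Lemma greedy_spec s : ints s 0 = sz -> ints s 1 = inc0 -> reals s 3 = CT -> (0 < F)%N ->
  greedy n F m incf Cf (reals s 9 0) (reals s 9 0 + reals s 9 0)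
    (mkseq (ints (den pGreedy s) 10) (ints s 6 0)).
Proof.
move=> s0 s1 s3 F0; rewrite /pGreedy !denE; set f := PFor 24 _ _; set u := den f s.
set g := reals s 9 0; set v := den _ u.
have [uN uR] := den_agree f s.
have u4 p : (p < n)%N -> reals u 4 p = g + g.
  rewrite /u; move: p.
  apply: (@for_invE _ n _ _ _ _ (fun j s' => forall p, (p < j)%N -> reals s' 4 p = g + g)) => //.
    by rewrite /= s0.
  move=> j s' jn ij [aN aR] IH p; rewrite !denE; simp; rewrite ij ltnS leq_eqVlt.
  by case: eqVneq => [-> _|_ /= /IH //]; rewrite (aR 9 isT).
pose P j s' := (forall p, (p < n)%N -> reals s' 4 p = relaxs Cf (g + g) (mkseq (ints s' 10) j) p) /\
  greedy n F m incf Cf g (g + g) (mkseq (ints s' 10) j).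
suff [] : P (ints s 6 0) v by [].
apply: for_invE => //.
- by rewrite /= (uN 6 isT).
- by split; [exact: u4|exact: greedy_nil].
move=> j s' jn ij [aN aR] [IH1 IH2].
have e0 : ints s' 0 = sz := etrans (aN 0%N isT) (etrans (uN 0%N isT) s0).
have e1 : ints s' 1 = inc0 := etrans (aN 1%N isT) (etrans (uN 1%N isT) s1).
have e3 : reals s' 3 = CT := etrans (aR 3 isT) (etrans (uR 3 isT) s3).
have e9 : reals s' 9 = reals s 9 := etrans (aR 9 isT) (uR 9 isT).
have [] := step_spec e0 e1 e3 F0; rewrite ij e9 -/g => yF ymin y4 y10.
set w := setN _ _ _ _; have w10 : ints w 10 = ints (den pStep s') 10 by [].
have mk : mkseq (ints (den pStep s') 10) j.+1 = rcons (mkseq (ints s' 10) j) (ints (den pStep s') 10 j).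
  rewrite mkseqS; congr rcons; apply/eq_in_map => t; rewrite mem_iota => /andP[_ tj].
  by rewrite y10 // ltn_eqF.
have rE x : forall p, (p < n)%N -> relax Cf (reals s' 4) x p =
    relax Cf (relaxs Cf (g + g) (mkseq (ints s' 10) j)) x p.
  by move=> p pn; rewrite /relax IH1.
rewrite /P w10 mk; split=> [p pn|].
  by rewrite /w /= y4 // rE // relaxs_rcons.
apply: greedy_rcons => // x xF; rewrite !relaxs_rcons.
by rewrite -!(eq_pot _ _ _ (rE _)); exact: ymin.
Qed.

Local Notation pt := (fun p j => ptA (p * d + j)%N).
Local Notation fc := (fun x j => facA (x * d + j)%N).

Definition offsets_ok s := forall x, (x < F)%N -> ints s 9 x = (x * d)%N.

Definition nearest_mid a b x := (x < F)%N /\ forall y, (y < F)%N ->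
  off_mid d (fc a) (fc b) (fc x) <= off_mid d (fc a) (fc b) (fc y).

Lemma dd_spec s : ints s 0 = sz -> reals s 1 = facA -> offsets_ok s ->
  (ints s 14 0 < F)%N -> (ints s 10 (ints s 27 0) < F)%N -> (ints s 10 (ints s 28 0) < F)%N ->
  reals (den pDD s) 13 0 = off_mid d (fc (ints s 10 (ints s 27 0)))
    (fc (ints s 10 (ints s 28 0))) (fc (ints s 14 0)) ^+ 2.
Proof.
move=> s0 s1 off xF aF bF; rewrite /pDD !denE; set u := setR s _ _ _.
rewrite sqr_nrm.
apply: (@for_invE _ d _ _ _ _ (fun j s' => reals s' 13 0 = dot j _ _)) => //.
- by rewrite /= s0.
- by rewrite /dot big_geq.
move=> j s' jn ij [aN aR] IH.
have e9 : ints s' 9 = ints s 9 := aN 9 isT.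
have e10 : ints s' 10 = ints s 10 := aN 10 isT.
have e14 : ints s' 14 = ints s 14 := aN 14 isT.
have e27 : ints s' 27 = ints s 27 := aN 27 isT.
have e28 : ints s' 28 = ints s 28 := aN 28 isT.
have e1 : reals s' 1 = facA := etrans (aR 1%N isT) s1.
rewrite !denE; simp; rewrite /dot big_nat_recr //= -/(dot _ _ _) IH.
by rewrite e9 e10 e14 e27 e28 e1 ij !off.
Qed.

Lemma mid_row_spec s a : ints s 0 = sz -> reals s 1 = facA -> offsets_ok s -> (0 < F)%N ->
  (forall t, (t < ints s 6 0)%N -> (ints s 10 t < F)%N) -> (a < ints s 6 0)%N ->
  ints s 27 0 = a -> ints s 13 0 = (a * ints s 6 0)%N ->
  let s' := den pMidRow s in
  [/\ ints s' 13 0 = (a.+1 * ints s 6 0)%N,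
   (forall c, (c < a * ints s 6 0)%N -> ints s' 11 c = ints s 11 c) &
   forall b, (b < ints s 6 0)%N ->
    nearest_mid (ints s 10 a) (ints s 10 b) (ints s' 11 (a * ints s 6 0 + b)%N)].
Proof.
move=> s0 s1 off F0 LF aT s27 s13 /=; set T := ints s 6 0; rewrite /pMidRow; set u := den _ s.
have -> : (a.+1 * T = a * T + T)%N by lia.
apply: (@for_invE _ T _ _ _ _ (fun b s' => [/\ ints s' 13 0 = (a * T + b)%N,
   (forall c, (c < a * T)%N -> ints s' 11 c = ints s 11 c) &
   forall c, (c < b)%N ->
    nearest_mid (ints s 10 a) (ints s 10 c) (ints s' 11 (a * T + c)%N)])) => //.
  by split=> //; rewrite addn0.
move=> b s' bT ib [aN aR] [IH1 IH2 IH3].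
have e0 : ints s' 0 = sz := etrans (aN 0%N isT) s0.
have e9 : ints s' 9 = ints s 9 := aN 9 isT.
have e10 : ints s' 10 = ints s 10 := aN 10 isT.
have e27 : ints s' 27 0 = a by rewrite (aN 27 isT).
have e1 : reals s' 1 = facA := etrans (aR 1%N isT) s1.
rewrite !denE; set v := den _ s'.
have [] := @argmin_spec pDD 13 (fun x => off_mid d (fc (ints s 10 a))
    (fc (ints s 10 b)) (fc x) ^+ 2) s' e0 F0 isT isT isT isT.
  move=> t [tN tR] tF.
  have t10 : ints t 10 = ints s 10 := etrans (tN 10 isT) e10.
  have t27 : ints t 27 0 = a by rewrite (tN 27 isT).
  have t28 : ints t 28 0 = b by rewrite (tN 28 isT).
  rewrite dd_spec ?t10 ?t27 ?t28 //.
  - exact: etrans (tN 0%N isT) e0.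
  - exact: etrans (tR 1%N isT) e1.
  - by move=> x xF; rewrite (tN 9 isT) e9 off.
  - exact: LF.
  - exact: LF.
rewrite -/v => rF rmin.
have v13 : ints v 13 0 = (a * T + b)%N by rewrite (den_ints (pArgmin pDD 13) _ 13 isT).
have v11 : ints v 11 = ints s' 11 := den_ints (pArgmin pDD 13) _ 11 isT.
simp; rewrite v13 v11; split.
- by rewrite addn1 addnS.
- by move=> c ca; rewrite ltn_eqF ?IH2 //; lia.
move=> c; rewrite ltnS eqn_add2l leq_eqVlt.
case: eqVneq => [-> _|_ /= /IH3 //]; split=> // y yF.
by have := rmin _ yF; rewrite ler_pXn2r ?nnegrE ?dist_ge0.
Qed.

Lemma mid_spec s : ints s 0 = sz -> reals s 1 = facA -> offsets_ok s -> (0 < F)%N ->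
  (forall t, (t < ints s 6 0)%N -> (ints s 10 t < F)%N) ->
  forall a b, (a < ints s 6 0)%N -> (b < ints s 6 0)%N ->
    nearest_mid (ints s 10 a) (ints s 10 b) (ints (den pMid s) 11 (a * ints s 6 0 + b)%N).
Proof.
move=> s0 s1 off F0 LF; rewrite /pMid !denE; set T := ints s 6 0; set u := setN s _ _ _.
suff [] : ints (den (PFor 27 (VN 6) pMidRow) u) 13 0 = (T * T)%N /\
    forall a b, (a < T)%N -> (b < T)%N -> nearest_mid (ints s 10 a) (ints s 10 b)
      (ints (den (PFor 27 (VN 6) pMidRow) u) 11 (a * T + b)%N) by [].
apply: (@for_invE _ T _ _ _ _ (fun j s' => ints s' 13 0 = (j * T)%N /\
    forall a b, (a < j)%N -> (b < T)%N -> nearest_mid (ints s 10 a) (ints s 10 b)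
      (ints s' 11 (a * T + b)%N))) => //.
move=> j s' jT ij [aN aR] [IH1 IH2].
have e6 : ints s' 6 = ints s 6 := aN 6 isT.
have e9 : ints s' 9 = ints s 9 := aN 9 isT.
have e10 : ints s' 10 = ints s 10 := aN 10 isT.
have := @mid_row_spec s' j (etrans (aN 0%N isT) s0) (etrans (aR 1%N isT) s1).
rewrite /offsets_ok e6 -/T e9 e10 => -[] // r1 r2 r3; split=> //.
move=> a b aj bT; have [aj'|aj'] := ltnP a j; last first.
  by have -> : a = j by [lia]; exact: r3.
simp; rewrite r2; first exact: IH2.
by have := leq_mul2r T a.+1 j; rewrite aj' orbT mulSn; lia.
Qed.

Lemma evalR_rpow s e z : evalR s (rpow e z) = evalR s e ^+ z.
Proof. by elim: z => //= z ->; rewrite exprS. Qed.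

Lemma offsets_spec s : ints s 0 = sz -> offsets_ok (den pOffsets s).
Proof.
move=> s0; rewrite /pOffsets !denE; set u := setN s _ _ _; set v := den _ u.
suff [] : ints v 13 0 = (F * d)%N /\ forall x, (x < F)%N -> ints v 9 x = (x * d)%N by [].
apply: (@for_invE _ F _ _ _ _ (fun j s' => ints s' 13 0 = (j * d)%N /\
  forall x, (x < j)%N -> ints s' 9 x = (x * d)%N)) => //.
  by rewrite /u; simp; rewrite s0.
move=> j s' jn ij [aN aR] [IH1 IH2].
have e0 : ints s' 0 = sz := etrans (aN 0%N isT) s0.
rewrite !denE; simp; rewrite e0 IH1 ij; split; first by rewrite mulSn addnC.
by move=> x; rewrite ltnS leq_eqVlt; case: eqVneq => [-> //|_ /= /IH2].
Qed.

Lemma sq_dist_spec s p x : ints s 0 = sz -> reals s 0 = ptA -> reals s 1 = facA ->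
  offsets_ok s -> ints s 23 0 = x -> (x < F)%N -> ints s 14 0 = (p * d)%N ->
  reals (den pSqDist s) 13 0 = dist d (pt p) (fc x) ^+ 2.
Proof.
move=> s0 r0 r1 off s23 xF s14; rewrite /pSqDist !denE; set u := setR s _ _ _.
rewrite sqr_nrm.
apply: (@for_invE _ d _ _ _ _ (fun j s' => reals s' 13 0 = dot j _ _)) => //.
- by rewrite /= s0.
- by rewrite /dot big_geq.
move=> j s' jn ij [aN aR] IH.
have e9 : ints s' 9 = ints s 9 := aN 9 isT.
have e14 : ints s' 14 0 = (p * d)%N by rewrite (aN 14 isT).
have e23 : ints s' 23 0 = x by rewrite (aN 23 isT).
have e0 : reals s' 0 = ptA := etrans (aR 0%N isT) r0.
have e1 : reals s' 1 = facA := etrans (aR 1%N isT) r1.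
rewrite !denE; simp; rewrite /dot big_nat_recr //= -/(dot _ _ _) IH.
by rewrite e9 e14 e23 e0 e1 ij off.
Qed.

Definition weighted z p x := wA p * dist d (pt p) (fc x) ^+ z.

Hypothesis wA_ge0 : forall p, 0 <= wA p.

Lemma weighted_ge0 z p x : 0 <= weighted z p x.
Proof. by rewrite mulr_ge0 // exprn_ge0 // dist_ge0. Qed.

Lemma table_row_spec z s p : ints s 0 = sz -> reals s 0 = ptA -> reals s 1 = facA ->
  reals s 2 = wA -> offsets_ok s -> ints s 14 0 = (p * d)%N -> ints s 24 0 = p ->
  ints s 13 0 = (p * F)%N ->
  let s' := den (pTableRow z) s in
  [/\ ints s' 13 0 = (p.+1 * F)%N,
    (forall c, (c < p * F)%N -> reals s' 3 c = reals s 3 c),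
    (forall x, (x < F)%N -> reals s' 3 (p * F + x)%N = weighted z p x),
    reals s 10 0 <= reals s' 10 0 &
    (forall x, (x < F)%N -> reals s 10 0 + weighted z p x <= reals s' 10 0) /\
    ((forall c, 0 <= reals s 3 c) -> forall c, 0 <= reals s' 3 c)].
Proof.
move=> s0 r0 r1 r2 off s14 s24 s13 /=; rewrite /pTableRow; set u := den _ s.
have -> : (p.+1 * F = p * F + F)%N by lia.
apply: (@for_invE _ F _ _ _ _ (fun j s' => [/\ ints s' 13 0 = (p * F + j)%N,
    (forall c, (c < p * F)%N -> reals s' 3 c = reals s 3 c),
    (forall x, (x < j)%N -> reals s' 3 (p * F + x)%N = weighted z p x),
    reals s 10 0 <= reals s' 10 0 &
    (forall x, (x < j)%N -> reals s 10 0 + weighted z p x <= reals s' 10 0) /\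
    ((forall c, 0 <= reals s 3 c) -> forall c, 0 <= reals s' 3 c)])) => //.
- by rewrite /= s0.
- by split=> //; rewrite addn0.
move=> j s' jF ij [aN aR] [IH1 IH2 IH3 IH4 [IH5 IH6]].
have e14 : ints s' 14 0 = (p * d)%N by rewrite (aN 14 isT).
have e24 : ints s' 24 0 = p by rewrite (aN 24 isT).
have e2 : reals s' 2 = wA := etrans (aR 2 isT) r2.
have off' : offsets_ok s' by move=> x xF; rewrite (aN 9 isT) off.
have sd := @sq_dist_spec s' p j (etrans (aN 0%N isT) s0) (etrans (aR 0%N isT) r0)
  (etrans (aR 1%N isT) r1) off' ij jF e14.
rewrite !denE; set v := den pSqDist s' in sd *.
have v2 : reals v 2 = wA := etrans (den_reals pSqDist s' 2 isT) e2.
have v3 : reals v 3 = reals s' 3 := den_reals pSqDist s' 3 isT.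
have v10 : reals v 10 = reals s' 10 := den_reals pSqDist s' 10 isT.
have v13 : ints v 13 0 = (p * F + j)%N by rewrite (den_ints pSqDist s' 13 isT).
have v24 : ints v 24 0 = p by rewrite (den_ints pSqDist s' 24 isT).
have wE : evalR v (RMul (RGet 2 (VN 24)) (rpow (RSqrt (VR 13)) z)) = weighted z p j.
  rewrite /= evalR_rpow /= sd sqrtr_sqr ger0_norm ?dist_ge0 // v2.
  by rewrite /= in v24; rewrite v24.
rewrite wE; simp; rewrite v13 v10 v3; have w0 := weighted_ge0 z p j; split.
- by rewrite addn1 addnS.
- by move=> c cp; rewrite ltn_eqF ?IH2 //; lia.
- move=> x; rewrite ltnS eqn_add2l leq_eqVlt.
  by case: eqVneq => [-> //|_ /= /IH3].
- by lra.
- split=> [x|/IH6 h c]; last by case: ifP.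
  by rewrite ltnS leq_eqVlt => /orP[/eqP ->|/IH5 h]; lra.
Qed.

(** Nonnegativity is propagated for all cells of real array 3, because the greedy analysis assumes
    it for all indices and the guesses read one entry past the table. *)
Lemma table_spec z s : ints s 0 = sz -> reals s 0 = ptA -> reals s 1 = facA ->
  reals s 2 = wA ->
  let s' := den (pTable z) s in
  [/\ offsets_ok s', (forall p x, (p < n)%N -> (x < F)%N ->
     reals s' 3 (p * F + x)%N = weighted z p x) &
   (forall p x, (p < n)%N -> (x < F)%N -> weighted z p x <= reals s' 10 0) /\
   ((forall c, 0 <= reals s 3 c) -> forall c, 0 <= reals s' 3 c)].
Proof.
move=> s0 r0 r1 r2 /=; rewrite /pTable 4!denE; have off := offsets_spec s0.
have [uN uR] := den_agree pOffsets s.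
set u := den pOffsets s in off uN uR *; rewrite !denE; set v := setR _ 10 _ _; set w := den _ v.
have offw : offsets_ok w by move=> x xF; rewrite (den_ints (PFor 24 nN (pTableRow z ;; 14 ::=N NAdd (VN 14) nD)) _ 9 isT); exact: off.
suff [] : [/\ ints w 13 0 = (n * F)%N, ints w 14 0 = (n * d)%N, 0 <= reals w 10 0,
  (forall p x, (p < n)%N -> (x < F)%N -> reals w 3 (p * F + x)%N = weighted z p x) &
  (forall p x, (p < n)%N -> (x < F)%N -> weighted z p x <= reals w 10 0) /\
   ((forall c, 0 <= reals s 3 c) -> forall c, 0 <= reals w 3 c)] by [].
apply: (@for_invE _ n _ _ _ _ (fun j s' => [/\ ints s' 13 0 = (j * F)%N,
   ints s' 14 0 = (j * d)%N, 0 <= reals s' 10 0,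
  (forall p x, (p < j)%N -> (x < F)%N -> reals s' 3 (p * F + x)%N = weighted z p x) &
  (forall p x, (p < j)%N -> (x < F)%N -> weighted z p x <= reals s' 10 0) /\
   ((forall c, 0 <= reals s 3 c) -> forall c, 0 <= reals s' 3 c)])) => //.
- by rewrite /v; simp; rewrite (uN 0%N isT) s0.
- by split=> //; split=> // h c; move: (h c); rewrite -(uR 3 isT).
move=> j s' jn ij [aN aR] [IH1 IH2 IH3 IH4 [IH5 IH6]].
have e0 : ints s' 0 = sz := etrans (aN 0%N isT) (etrans (uN 0%N isT) s0).
have f0 : reals s' 0 = ptA := etrans (aR 0%N isT) (etrans (uR 0%N isT) r0).
have f1 : reals s' 1 = facA := etrans (aR 1%N isT) (etrans (uR 1%N isT) r1).
have f2 : reals s' 2 = wA := etrans (aR 2 isT) (etrans (uR 2 isT) r2).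
have off' : offsets_ok s' by move=> x xF; rewrite (aN 9 isT); exact: off.
have [h1 h2 h3 h4 [h5 h6]] := @table_row_spec z s' j e0 f0 f1 f2 off' IH2 ij IH1.
rewrite !denE; set t := den _ s' in h1 h2 h3 h4 h5 h6 *.
have t0 : ints t 0 = sz := etrans (den_ints (pTableRow z) s' 0%N isT) e0.
have t14 : ints t 14 = ints s' 14 := den_ints (pTableRow z) s' 14 isT.
simp; rewrite t0 t14; split=> //.
- by rewrite IH2 mulSn addnC.
- exact: le_trans h4.
- move=> p x; rewrite ltnS leq_eqVlt => /orP[/eqP -> /h3 //|pj xF].
  rewrite h2; first exact: IH4.
  by have := leq_mul2r F p.+1 j; rewrite pj orbT mulSn; lia.
- split=> [p x|/IH6 /h6 //].
  rewrite ltnS leq_eqVlt => /orP[/eqP -> /h5|pj xF]; first by lra.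
  exact: le_trans (IH5 _ _ pj xF) h4.
Qed.

End Specs.


(** * Search over guesses and tuples, and selection of the output *)

Definition pSelect : prog :=
  PIf (BLeN (NGet 12 (VN 14)) Z0)
    (PSetN 12 (VN 14) N1 ;; 18 ::=N NAdd (VN 18) N1) PSkip.

(** Division by T^2 through repeated subtraction. The number of tuples is a loop bound fixed in
    advance that exceeds every quotient. This loop sits inside the loop over all tuples, so the
    running time contains the square of their number. *)
Definition pDigit : prog :=
  17 ::=N Z0 ;;
  PFor 30 (VN 8) (PIf (BLeN (VN 7) (VN 16))
    (16 ::=N NSub (VN 16) (VN 7) ;; 17 ::=N NAdd (VN 17) N1) PSkip).

Definition pPick : prog :=
  PFor 31 nK (
    pDigit ;; 14 ::=N NGet 11 (VN 16) ;; 16 ::=N VN 17 ;;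
    pSelect ;; pTry ;; pCommit).

Definition pPad : prog := PFor 14 nF (PIf (BLeN nK (VN 18)) PSkip pSelect).

Definition pKeep : prog :=
  PIf (BAnd (BLeN N1 (VN 19)) (BLeR (VR 12) (VR 8))) PSkip
    (12 ::=R VR 8 ;; 19 ::=N N1 ;; PFor 23 nF (PSetN 2 (VN 23) (NGet 12 (VN 23)))).

Definition pReset : prog :=
  16 ::=N VN 29 ;; 18 ::=N Z0 ;; PFor 23 nF (PSetN 12 (VN 23) Z0) ;;
  PFor 24 nN (PSetR 4 (VN 24) (VR 10)).

(** The group costs are computed before padding, so the recorded value is an upper bound for the
    cost of the padded set. *)
Definition pEval : prog := pReset ;; pPick ;; pGroups ;; pPad ;; pKeep.

Definition pGuess : prog :=
  9 ::=R RDiv (RMul (RGet 3 (VN 20)) (RNat (VN 21))) (RNat (NConst 16)) ;;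
  pGreedy ;; pMid ;; PFor 29 (VN 8) pEval.

Definition pMain : prog := 19 ::=N Z0 ;; PFor 20 (VN 5) (PFor 21 (VN 3) pGuess).

Section Specs.
Variable R : realType.
Implicit Types s : state R.
Variables (sz inc0 : nat -> nat) (facA CT : nat -> R) (J N T : nat) (BIG : R).
Local Notation n := (sz 0).
Local Notation F := (sz 1).
Local Notation m := (sz 2).
Local Notation d := (sz 3).
Local Notation k := (sz 4).
Local Notation Cf := (fun p x => CT (p * F + x)%N).
Local Notation incf := (fun i p => (0 < inc0 (i * n + p))%N).
Local Notation T2 := (T * T)%N.
Local Notation E := ((T * T) ^ k)%N.

(** Input and precomputed data that the search reads and never overwrites. *)
Definition ctx s := [/\ ints s 0 = sz, ints s 1 = inc0, reals s 1 = facA, reals s 3 = CT &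
  [/\ ints s 3 0 = J, ints s 5 0 = N, ints s 6 0 = T, ints s 7 0 = T2 &
  [/\ ints s 8 0 = E, reals s 10 0 = BIG & offsets_ok sz s]]].

Lemma ctx_agree WN WR s s' : agree WN WR s s' ->
  all (fun a => a \notin WN) [:: 0; 1; 3; 5; 6; 7; 8; 9]%N ->
  all (fun a => a \notin WR) [:: 1; 3; 10]%N -> ctx s -> ctx s'.
Proof.
move=> [aN aR] /and5P[w0 w1 w3 w5 /and5P[w6 w7 w8 w9 _]] /and4P[r1 r3 r10 _].
case=> ? ? ? ? [? ? ? ? [? ? off]].
do ![split]; rewrite ?aN ?aR // => x xF; rewrite aN //; exact: off.
Qed.

Definition cnt (f : nat -> nat) := (\sum_(0 <= x < F) (f x != 0))%N.

Lemma select_spec s : (ints s 14 0 < F)%N -> ints s 18 0 = cnt (ints s 12) ->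
  let s' := den pSelect s in
  [/\ ints s' 18 0 = cnt (ints s' 12), ints s' 12 (ints s 14 0) != 0%N,
    (forall y, ints s 12 y != 0%N -> ints s' 12 y != 0%N) &
    (ints s' 18 0 <= (ints s 18 0).+1)%N].
Proof.
move=> xF c; rewrite /= /pSelect denE /=; set x := ints s 14 0 in xF *.
rewrite leqn0; case: eqVneq => x0.
  simp; rewrite !eqxx; split=> //; last by rewrite addn1.
    rewrite c /cnt !big_mkord (bigD1 (Ordinal xF)) //= [RHS](bigD1 (Ordinal xF)) //=.
    rewrite eqxx x0 add0n addn1 add1n; congr S; apply: eq_bigr => y yx.
    by rewrite (_ : (y : nat) == x = false) //; apply/negbTE; apply: contraNN yx => /eqP yx; apply/eqP/val_inj.
  by move=> y yn; case: ifP.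
by split.
Qed.

Lemma digit_spec s (q b e : nat) : ints s 16 0 = q -> ints s 7 0 = b -> ints s 8 0 = e ->
  (0 < b)%N -> (q < e)%N ->
  ints (den pDigit s) 16 0 = (q %% b)%N /\ ints (den pDigit s) 17 0 = (q %/ b)%N.
Proof.
move=> sq sb se b0 qe; rewrite /pDigit !denE; set u := setN s _ _ _; set v := den _ u.
(* Either the remainder is already small or every round has subtracted. The second alternative after
   [e] rounds would give q >= e b >= e. *)
pose P j s' := (ints s' 17 0 * b + ints s' 16 0 = q)%N /\
  ((ints s' 16 0 < b)%N \/ (j <= ints s' 17 0)%N).
suff [qE [lt|ge]] : P e v.
- by rewrite -qE modnMDl modn_small // divnMDl // divn_small // addn0.
- have := leq_mul ge b0; rewrite muln1; lia.
apply: for_invE => //.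
  by split; [rewrite /u; simp; rewrite sq|right].
move=> j s' jn ij [aN aR] [IH1 IH2].
have e7 : ints s' 7 0 = b by rewrite (aN 7 isT).
rewrite !denE /= e7; case: leqP => c; rewrite /P; simp; rewrite ?e7; last by split=> //; left.
split; first by rewrite addn1 mulSn; lia.
by case: IH2 => [lt|le]; [lia|right; lia].
Qed.

(* The tuple with code [e] has as entries the digits of [e] in base T^2. *)
Definition dg (e i : nat) := ((e %/ T2 ^ i) %% T2)%N.

Definition centers (M : nat -> nat) e j := mkseq (fun i => M (dg e i)) j.

Hypothesis T_gt0 : (0 < T)%N.
Hypothesis k_gt0 : (0 < k)%N.
Hypothesis k_le : (k <= F)%N.

Lemma T2_gt0 : (0 < T2)%N. Proof. by rewrite muln_gt0 T_gt0. Qed.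

Lemma dg_lt e i : (dg e i < T2)%N.
Proof. by rewrite ltn_mod T2_gt0. Qed.

Lemma reset_spec s e : ctx s -> ints s 29 0 = e ->
  let s' := den pReset s in
  [/\ ctx s', ints s' 16 0 = e, ints s' 18 0 = cnt (ints s' 12), ints s' 18 0 = 0%N &
    forall p, (p < n)%N -> reals s' 4 p = BIG].
Proof.
move=> cs s29 s'; have cs' : ctx s' by apply: ctx_agree cs; first exact: den_agree.
move: cs cs'; rewrite /s' => -[s0 _ _ _ [_ _ _ _ [_ sB _]]] cs'.
split=> //; rewrite /pReset !denE.
- by rewrite (den_ints (PFor 24 nN _)) // (den_ints (PFor 23 nF _)).
- rewrite (den_ints (PFor 24 nN _)) // (den_ints (PFor 23 nF _)) //.
  rewrite (den_ints (PFor 24 nN _)) //; set u := setN _ 18 _ _; set v := den _ u.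
  suff v0 : forall x, (x < F)%N -> ints v 12 x = 0%N.
    rewrite /cnt big_nat big1 // => x /andP[_ xF]; by rewrite v0.
  apply: (@for_invE _ F _ _ _ _ (fun j s' => forall x, (x < j)%N -> ints s' 12 x = 0%N)) => //.
    by rewrite /u; simp; rewrite s0.
  move=> j t jF ij [aN aR] IH x; rewrite !denE; simp; rewrite ij ltnS leq_eqVlt.
  by case: eqVneq => [//|_ /= /IH].
- by rewrite (den_ints (PFor 24 nN _)) // (den_ints (PFor 23 nF _)).
set u := den _ (setN _ 18 _ _).
have [uN uR] : agree [:: 16; 18; 23; 12]%N [::] s u.
  apply: agree_trans (agree_sub _ _ (den_agree _ _)) => //.
    by apply: agree_trans (agree_setN _ _ _ _ _) (agree_setN _ _ _ _ _).
  by move=> a; rewrite !inE => /orP[] ->; rewrite ?orbT.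
apply: (@for_invE _ n _ _ _ _ (fun j s' => forall p, (p < j)%N -> reals s' 4 p = BIG)) => //.
  by rewrite /= (uN 0%N isT) s0.
move=> j t jn ij [aN aR] IH p; rewrite !denE; simp; rewrite ij ltnS leq_eqVlt.
by case: eqVneq => [-> _|_ /= /IH //]; rewrite (aR 10 isT) (uR 10 isT).
Qed.

Lemma pick_spec s e M : ctx s -> (e < E)%N -> ints s 16 0 = e -> ints s 11 = M ->
  (forall c, (c < T2)%N -> (M c < F)%N) ->
  ints s 18 0 = cnt (ints s 12) -> ints s 18 0 = 0%N ->
  (forall p, (p < n)%N -> reals s 4 p = BIG) ->
  let s' := den pPick s in
  [/\ ints s' 18 0 = cnt (ints s' 12), (ints s' 18 0 <= k)%N,
    (forall x, x \in centers M e k -> ints s' 12 x != 0%N) &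
    forall p, (p < n)%N -> reals s' 5 p = relaxs Cf BIG (centers M e k) p].
Proof.
move=> cs eE s16 s11 MF sc s18 s4 /=; rewrite /pPick; set u := den _ s.
have s0 : ints s 0 = sz by case: cs.
(* [pGroups] reads array 5, which is meaningful only after a pick; as k > 0, there is one. *)
pose P j s' := [/\ ints s' 16 0 = (e %/ T2 ^ j)%N, ints s' 18 0 = cnt (ints s' 12),
  (ints s' 18 0 <= j)%N, (forall x, x \in centers M e j -> ints s' 12 x != 0%N) &
  (forall p, (p < n)%N -> reals s' 4 p = relaxs Cf BIG (centers M e j) p) /\
  ((0 < j)%N -> forall p, (p < n)%N -> reals s' 5 p = relaxs Cf BIG (centers M e j) p)].
suff : P k u by case=> _ h1 h2 h3 [_ h4]; split=> //; exact: h4.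
apply: for_invE => //.
- by rewrite /= s0.
- split=> //; rewrite ?expn0 ?divn1 //; first by rewrite (_ : ints _ 18 0 = 0%N).
move=> j s' jk ij ag [IH1 IH2 IH3 IH4 [IH5 _]].
have cs' : ctx s' by apply: ctx_agree cs; first exact: ag.
have [c0 _ _ c3 [_ _ _ c7 [c8 cB _]]] := cs'.
have e11 : ints s' 11 = M by rewrite (proj1 ag 11 isT).
rewrite !denE; set t1 := den pDigit s'.
have [] := @digit_spec s' _ _ _ IH1 c7 c8 T2_gt0.
  by apply: leq_ltn_trans eE; exact: leq_div.
rewrite -/t1 -/(dg e j) => d16 d17.
have [tN tR] : agree (modN pDigit) (modR pDigit) s' t1 := den_agree _ _.
set t2 := setN t1 14 _ _; set t3 := setN t2 16 _ _.
have x14 : ints t3 14 0 = M (dg e j).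
  by rewrite /t3 /t2; simp; rewrite (tN 11 isT) e11 d16.
have [] := @select_spec t3.
- by rewrite x14; apply: MF; exact: dg_lt.
- by rewrite /t3 /t2; simp; rewrite (tN 18 isT) (tN 12 isT).
set t4 := den pSelect t3; set t5 := den pTry t4; set t6 := den pCommit t5.
rewrite x14 => h1 h2 h3 h4.
have t50 : ints t5 0 = sz.
  by rewrite /t5 (den_ints pTry) // /t4 (den_ints pSelect) // -c0 -(tN 0%N isT).
have t43 : reals t4 3 = CT by rewrite /t4 (den_reals pSelect) // -c3 -(tR 3 isT).
have t40 : ints t4 0 = sz by rewrite -t50 /t5 (den_ints pTry).
have t44 : reals t4 4 = reals s' 4 by rewrite /t4 (den_reals pSelect) // -(tR 4 isT).
have t414 : ints t4 14 0 = M (dg e j) by rewrite /t4 (den_ints pSelect).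
have t5E p : (p < n)%N -> reals t5 5 p = relaxs Cf BIG (centers M e j.+1) p.
  move=> pn; rewrite /t5 (try_spec t40 t43) // t414 t44.
  by rewrite /centers mkseqS relaxs_rcons /relax IH5.
have t6N a : a \notin modN pCommit -> a \notin modN pTry -> ints t6 a = ints t4 a.
  by move=> *; rewrite /t6 (den_ints pCommit) // /t5 (den_ints pTry).
have i18 : ints (setN t6 31 0 j.+1) 18 = ints t4 18 := t6N 18 isT isT.
have i12 : ints (setN t6 31 0 j.+1) 12 = ints t4 12 := t6N 12 isT isT.
rewrite /P i18 i12; split.
- simp; rewrite t6N // /t4 (den_ints pSelect) //.
  by rewrite /t3; simp; rewrite d17 -divnMA -expnSr.
- exact: h1.
- apply: leq_trans h4 _; rewrite ltnS /t3 /t2; simp.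
  by rewrite (tN 18 isT).
- move=> x; rewrite /centers mkseqS mem_rcons inE => /orP[/eqP -> //|/IH4 xs].
  by apply: h3; rewrite /t3 /t2; simp; rewrite (tN 12 isT).
split=> [p pn|_ p pn].
  by rewrite /= (commit_spec t50) // t5E.
by rewrite /= /t6 (den_reals pCommit) // t5E.
Qed.

Lemma pad_spec s : ints s 0 = sz -> ints s 18 0 = cnt (ints s 12) -> (ints s 18 0 <= k)%N ->
  cnt (ints (den pPad s) 12) = k /\
  forall x, ints s 12 x != 0%N -> ints (den pPad s) 12 x != 0%N.
Proof.
move=> s0 sc sk; rewrite /pPad; set u := den _ s.
(* As long as k is not reached, every facility passed is selected; if that lasts to the end, all F
   >= k facilities are. *)
pose P j s' := [/\ ints s' 18 0 = cnt (ints s' 12), (ints s' 18 0 <= k)%N,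
  (forall x, ints s 12 x != 0%N -> ints s' 12 x != 0%N) &
  ints s' 18 0 = k \/ forall x, (x < j)%N -> ints s' 12 x != 0%N].
suff : P F u.
  case=> h1 h2 h3 [h4|h4]; split=> //; rewrite -?h1 //.
  apply/eqP; rewrite eqn_leq h2 h1 (leq_trans k_le) // /cnt.
  rewrite big_nat (eq_bigr (fun=> 1%N)); last by move=> x /andP[_ /h4 ->].
  by rewrite -big_nat sum_nat_const_nat muln1 subn0.
apply: for_invE => //.
- by rewrite /= s0.
- by split=> //; right.
move=> j s' jF ij [aN aR] [IH1 IH2 IH3 IH4].
have e0 : ints s' 0 = sz := etrans (aN 0%N isT) s0.
rewrite denE /= e0; case: leqP => c.
  by split=> //; left; apply/eqP; rewrite eqn_leq IH2.
have [] := @select_spec s'; rewrite ?ij // => h1 h2 h3 h4.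
split=> //; first by apply: leq_trans h4 _.
  by move=> x /IH3 /h3.
right=> x; rewrite ltnS leq_eqVlt => /orP[/eqP -> //|xj].
by apply: h3; case: IH4 => [h|/(_ _ xj) //]; rewrite h ltnn in c.
Qed.

(* The output is at least as good as some evaluated tuple with connection costs
   [psi] (padding the tuple to k facilities only lowers the cost). *)
Definition best_inv s := ints s 19 0 != 0%N -> cnt (ints s 2) = k /\
  exists2 psi, reals s 12 0 = maxsum n m incf psi &
    forall p, (p < n)%N -> exists x, [/\ (x < F)%N, ints s 2 x != 0%N & Cf p x <= psi p].

Definition improves s s' := ints s 19 0 != 0%N ->
  ints s' 19 0 != 0%N /\ reals s' 12 0 <= reals s 12 0.

Lemma keep_spec s psi : ints s 0 = sz -> best_inv s -> cnt (ints s 12) = k ->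
  reals s 8 0 = maxsum n m incf psi ->
  (forall p, (p < n)%N -> exists x, [/\ (x < F)%N, ints s 12 x != 0%N & Cf p x <= psi p]) ->
  let s' := den pKeep s in
  [/\ best_inv s', improves s s', ints s' 19 0 != 0%N & reals s' 12 0 <= maxsum n m incf psi].
Proof.
move=> s0 bi sc s8 cov /=; rewrite /pKeep denE /=.
case: ifPn => [/andP[h c]|nc].
  by rewrite denE; split=> //; rewrite -?lt0n // -s8.
rewrite !denE; set u := setN _ 19 _ _; set v := den _ u.
have v2 x : (x < F)%N -> ints v 2 x = ints s 12 x.
  rewrite /v; move: x; apply: (@for_invE _ F _ _ _ _ (fun j s' =>
      forall x, (x < j)%N -> ints s' 2 x = ints s 12 x)) => //.
    by rewrite /u; simp; rewrite s0.
  move=> j t jF ij [aN aR] IH x; rewrite !denE; simp; rewrite ij ltnS leq_eqVlt.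
  by case: eqVneq => [-> _|_ /= /IH //]; rewrite (aN 12 isT).
have v12 : reals v 12 0 = reals s 8 0 by rewrite /v (den_reals (PFor 23 nF _)).
have v19 : ints v 19 0 = 1%N by rewrite /v (den_ints (PFor 23 nF _)).
split.
- move=> _; split.
    by rewrite -sc /cnt; apply: eq_big_nat => x /andP[_ /v2 ->].
  exists psi; first by rewrite v12.
  by move=> p /cov [x [xF x0 xc]]; exists x; rewrite v2.
- move=> h; rewrite v19 v12; split=> //; move: nc; rewrite lt0n h /= -ltNge; exact: ltW.
- by rewrite v19.
- by rewrite v12 s8.
Qed.

Lemma eval_spec s e M : ctx s -> (e < E)%N -> ints s 29 0 = e -> ints s 11 = M ->
  (forall c, (c < T2)%N -> (M c < F)%N) ->
  (forall p x, (p < n)%N -> (x < F)%N -> Cf p x <= BIG) -> best_inv s ->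
  let s' := den pEval s in
  [/\ best_inv s', improves s s', ints s' 19 0 != 0%N &
    reals s' 12 0 <= maxsum n m incf (relaxs Cf BIG (centers M e k))].
Proof.
move=> cs eE s29 s11 MF bigP bi /=; rewrite /pEval !denE.
have [] := reset_spec cs s29; set t1 := den pReset s => c1 t16 tc t18 t4.
have t11 : ints t1 11 = M by rewrite /t1 (den_ints pReset).
have [] := pick_spec c1 eE t16 t11 MF tc t18 t4; set t2 := den pPick t1 => h1 h2 h3 h4.
have t20 : ints t2 0 = sz by rewrite /t2 (den_ints pPick) //; case: c1.
have t21 : ints t2 1 = inc0 by rewrite /t2 (den_ints pPick) //; case: c1.
have [_] := groups_spec t20 t21; set t3 := den pGroups t2; rewrite (eq_maxsum _ _ h4) => t38.
have t30 : ints t3 0 = sz by rewrite /t3 (den_ints pGroups).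
have t318 : ints t3 18 = ints t2 18 by rewrite /t3 (den_ints pGroups).
have t312 : ints t3 12 = ints t2 12 by rewrite /t3 (den_ints pGroups).
have [||p1 p2] := @pad_spec t3 t30; rewrite ?t318 ?t312 //.
set t5 := den pPad t3 in p1 p2 *.
have t50 : ints t5 0 = sz by rewrite /t5 (den_ints pPad).
have t58 : reals t5 8 = reals t3 8 by rewrite /t5 (den_reals pPad).
have t519 : ints t5 19 = ints s 19.
  rewrite /t5 (den_ints pPad) // /t3 (den_ints pGroups) // /t2 (den_ints pPick) //.
  by rewrite /t1 (den_ints pReset).
have t52 : ints t5 2 = ints s 2.
  rewrite /t5 (den_ints pPad) // /t3 (den_ints pGroups) // /t2 (den_ints pPick) //.
  by rewrite /t1 (den_ints pReset).
have t512 : reals t5 12 = reals s 12.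
  rewrite /t5 (den_reals pPad) // /t3 (den_reals pGroups) // /t2 (den_reals pPick) //.
  by rewrite /t1 (den_reals pReset).
have [||||k1 k2 k3 k4] := @keep_spec t5 (relaxs Cf BIG (centers M e k)) t50.
- by rewrite /best_inv t519 t512 t52.
- exact: p1.
- by rewrite t58.
- move=> p pn; have cF x : x \in centers M e k -> (x < F)%N.
    by case/mapP => i _ ->; apply: MF; exact: dg_lt.
  (* A point still at the initial value [BIG] is served by the first center of the tuple, since
     [BIG] bounds all connection costs. *)
  case: (relaxs_attained Cf BIG (centers M e k) p) => [->|[x xc ->]].
    have xc : M (dg e 0) \in centers M e k.
      by apply/mapP; exists 0%N => //; rewrite mem_iota.
    by exists (M (dg e 0)); split; [exact: cF|apply: p2; rewrite t312; exact: h3|apply: bigP (cF _ xc)].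
  by exists x; split; [exact: cF|apply: p2; rewrite t312; exact: h3|].
by split=> //; rewrite /improves -t519 -t512.
Qed.

Lemma improves_trans s1 s2 s3 : improves s1 s2 -> improves s2 s3 -> improves s1 s3.
Proof.
move=> h1 h2 /h1 [a b]; have [c e] := h2 a; split=> //; exact: le_trans e b.
Qed.

(** The list and the candidates are existential because the next guess overwrites them. The property
    only improves when [b] decreases, so it survives the later rounds. *)
Definition explored (b : R) idx j := let g := CT idx * j%:R / 16 in
  exists L M, [/\ greedy n F m incf Cf g (g + g) L, size L = T,
    (forall a c, (a < T)%N -> (c < T)%N ->
       nearest_mid sz facA (nth 0%N L a) (nth 0%N L c) (M (a * T + c)%N)) &
    forall e, (e < E)%N -> b <= maxsum n m incf (relaxs Cf BIG (centers M e k))].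

Lemma explored_le b b' idx j : b' <= b -> explored b idx j -> explored b' idx j.
Proof.
move=> bb [L [M [h1 h2 h3 h4]]]; exists L, M; split=> // e eE.
exact: le_trans bb (h4 _ eE).
Qed.

Hypothesis le_BIG : forall p x, (p < n)%N -> (x < F)%N -> Cf p x <= BIG.

Lemma guess_spec s : ctx s -> best_inv s ->
  let s' := den pGuess s in
  [/\ best_inv s', improves s s', ints s' 19 0 != 0%N &
    explored (reals s' 12 0) (ints s 20 0) (ints s 21 0)].
Proof.
move=> cs bi /=; rewrite /pGuess !denE; set g := evalR s _; set u := setR s _ _ _.
have F_gt0 : (0 < F)%N := leq_trans k_gt0 k_le.
have E_gt0 : (0 < E)%N by rewrite expn_gt0 T2_gt0.
have cu : ctx u by apply: (ctx_agree (agree_setR [::] s 0 g (mem_head 9%N [::]))).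
set v := den pGreedy u; have cv : ctx v by apply: (ctx_agree (den_agree pGreedy u)).
set w := den pMid v; have cw : ctx w by apply: (ctx_agree (den_agree pMid v)).
have u6 : ints u 6 0 = T by case: cu => _ _ _ _ [].
have v6 : ints v 6 0 = T by case: cv => _ _ _ _ [].
have gr : greedy n F m incf Cf g (g + g) (mkseq (ints v 10) T).
  by case: cu => u0 u1 _ u3 _; have := greedy_spec u0 u1 u3 F_gt0; rewrite u6.
have LF t : (t < T)%N -> (ints v 10 t < F)%N.
  by move=> tT; apply: (greedy_lt gr); apply: map_f; rewrite mem_iota.
have near a b : (a < T)%N -> (b < T)%N ->
    nearest_mid sz facA (ints v 10 a) (ints v 10 b) (ints w 11 (a * T + b)%N).
  case: cv => v0 _ v1 _ [_ _ _ _ [_ _ off]].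
  have := mid_spec v0 v1 off F_gt0; rewrite v6 => H; exact: H.
have MF c : (c < T2)%N -> (ints w 11 c < F)%N.
  move=> cT; rewrite (divn_eq c T); apply: (proj1 (near _ _ _ _)).
    by rewrite ltn_divLR.
  by rewrite ltn_mod.
have vN a : a \notin modN pMid -> a \notin modN pGreedy -> ints w a = ints s a.
  by move=> *; rewrite /w (den_ints pMid) // /v (den_ints pGreedy).
have w19 : ints w 19 = ints s 19 by rewrite vN.
have w2 : ints w 2 = ints s 2 by rewrite vN.
have w12 : reals w 12 = reals s 12.
  by rewrite /w (den_reals pMid) // /v (den_reals pGreedy).
have biw : best_inv w by rewrite /best_inv w19 w2 w12.
set x := den _ w.
pose P j s' := [/\ ints s' 11 = ints w 11, best_inv s', improves s s', ((0 < j)%N -> ints s' 19 0 != 0%N) &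
  forall e, (e < j)%N -> reals s' 12 0 <= maxsum n m incf (relaxs Cf BIG (centers (ints w 11) e k))].
suff : P E x.
  case=> _ h1 h2 h3 h4; split=> //; first exact: h3.
  have gE : g = CT (ints s 20 0) * (ints s 21 0)%:R / 16.
    by case: cs => _ _ _ s3 _; rewrite /g /= s3.
  rewrite /explored -gE; exists (mkseq (ints v 10) T), (ints w 11); split; [exact: gr|exact: size_mkseq| |exact: h4].
  by move=> a c aT cT; rewrite !nth_mkseq //; exact: near.
apply: for_invE => //.
- by case: cw => _ _ _ _ [_ _ _ _ []].
- by split=> //; rewrite /improves -w19 -w12 => h; split.
move=> j s' jE ij ag [IH1 IH2 IH3 IH4 IH5].
have cs' : ctx s' by apply: (ctx_agree ag).
have [h1 h2 h3 h4] := eval_spec cs' jE ij IH1 MF le_BIG IH2.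
split=> //.
- by rewrite -IH1 /= -(den_ints pEval s' 11 isT).
- exact: improves_trans h2.
- move=> e; rewrite ltnS leq_eqVlt => /orP[/eqP -> //|ej].
  have [_ le] := h2 (IH4 (leq_ltn_trans (leq0n _) ej)).
  exact: le_trans le (IH5 _ ej).
Qed.

Lemma main_spec s : ctx s -> (0 < N)%N -> (0 < J)%N ->
  let s' := den pMain s in
  [/\ best_inv s', ints s' 19 0 != 0%N &
    forall idx j, (idx < N)%N -> (j < J)%N -> explored (reals s' 12 0) idx j].
Proof.
move=> cs N0 J0 /=; rewrite /pMain !denE; set u := setN s _ _ _.
have cu : ctx u by apply: (ctx_agree (agree_setN [::] s 0 0%N (mem_head 19%N [::]))).
set v := den _ u.
pose Q jj ii (s' : state R) := forall idx j, (idx < jj)%N -> (j < ii)%N ->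
  explored (reals s' 12 0) idx j.
pose P i s' := [/\ best_inv s', ((0 < i)%N -> ints s' 19 0 != 0%N) & Q i J s'].
suff : P N v by case=> h1 h2 h3; split=> //; exact: h2.
apply: for_invE => //.
- by case: cu => _ _ _ _ [].
move=> i s' iN ii ag [IH1 IH2 IH3].
have cs' : ctx s' by apply: (ctx_agree ag).
suff [h1 h2 h3 h4] : [/\ best_inv (den (PFor 21 (VN 3) pGuess) s'),
    ((0 < J)%N -> ints (den (PFor 21 (VN 3) pGuess) s') 19 0 != 0%N),
    improves s' (den (PFor 21 (VN 3) pGuess) s') &
    forall j, (j < J)%N -> explored (reals (den (PFor 21 (VN 3) pGuess) s') 12 0) i j].
  split=> //; first by move=> _; exact: h2.
  move=> idx j; rewrite ltnS leq_eqVlt => /orP[/eqP -> jJ|ix jJ]; first exact: h4.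
  apply: explored_le (IH3 _ _ ix jJ).
  by have [] := h3 (IH2 (leq_ltn_trans (leq0n _) ix)).
apply: (@for_invE _ J _ _ _ _ (fun j t => [/\ best_inv t, ((0 < j)%N -> ints t 19 0 != 0%N),
  improves s' t & forall l, (l < j)%N -> explored (reals t 12 0) i l])) => //.
- by case: cs' => _ _ _ _ [].
move=> j t jJ ij at_ [K1 K2 K3 K4].
have ct : ctx t by apply: (ctx_agree at_).
have [] := guess_spec ct K1; rewrite ij (proj1 at_ 20 isT) ii => h1 h2 h3 h4.
split=> //; first exact: improves_trans h2.
move=> l; rewrite ltnS leq_eqVlt => /orP[/eqP -> //|lj].
apply: explored_le (K4 _ lj).
by have [] := h2 (K2 (leq_ltn_trans (leq0n _) lj)).
Qed.

End Specs.


(** * Computation of the loop bounds *)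

Notation "a +=N e" := (PSetN a Z0 (NAdd (VN a) e)) (at level 55).

(** The bounds are 16n + 1, 32(mn + 1) and nF + 1. The added units keep the search loops nonempty
    and the logarithm positive even for n = 0, so that an output is always set. *)
Definition pSizes : prog :=
  3 ::=N N1 ;; PFor 20 nN (3 +=N NConst 16) ;;
  4 ::=N NConst 32 ;; PFor 20 nM (PFor 21 nN (4 +=N NConst 32)) ;;
  5 ::=N N1 ;; PFor 20 nN (PFor 21 nF (5 +=N N1)).

Definition pLog : prog :=
  13 ::=N N1 ;; 14 ::=N Z0 ;;
  PFor 20 (VN 4) (PIf (BLeN (VN 13) (VN 4)) (13 +=N VN 13 ;; 14 +=N N1) PSkip) ;;
  6 ::=N Z0 ;; PFor 20 nK (6 +=N VN 14).

Definition pSquare : prog := 7 ::=N Z0 ;; PFor 20 (VN 6) (PFor 21 (VN 6) (7 +=N N1)).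

Definition pPower : prog :=
  8 ::=N N1 ;;
  PFor 20 nK (13 ::=N Z0 ;; PFor 21 (VN 7) (13 +=N VN 8) ;; 8 ::=N VN 13).

Section Setup.
Variable R : realType.
Implicit Types s : state R.

Lemma add_loop a i e c s : i != a -> all (fun x => x \notin [:: i; a]) (rdN c) ->
  ints (den (PFor i e (a +=N c)) s) a 0 = (ints s a 0 + evalN s e * evalN s c)%N.
Proof.
move=> ia ec; apply: (for_inv (P := fun j s' => ints s' a 0 = (ints s a 0 + j * evalN s c)%N)).
- by rewrite inE.
- by simp; rewrite eq_sym (negbTE ia) addn0.
move=> j s' _ _ ag IH; rewrite denE; simp; rewrite eq_sym (negbTE ia) eqxx /=.
by rewrite eqxx IH (evalN_agree ag ec) mulSnr addnA.
Qed.

Lemma add_loop2 a i j e1 e2 c s : i != a -> j != a -> i != j ->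
  all (fun x => x \notin [:: i; j; a]) (rdN c) ->
  all (fun x => x \notin [:: i; j; a]) (rdN e2) ->
  ints (den (PFor i e1 (PFor j e2 (a +=N c))) s) a 0 =
    (ints s a 0 + evalN s e1 * (evalN s e2 * evalN s c))%N.
Proof.
move=> ia ja ij ec ee.
apply: (for_inv (P := fun l s' => ints s' a 0 = (ints s a 0 + l * (evalN s e2 * evalN s c))%N)).
- by rewrite !inE negb_or ia ij.
- by simp; rewrite eq_sym (negbTE ia) addn0.
move=> l s' _ _ ag IH; simp; rewrite eq_sym (negbTE ia) /= add_loop //.
  by rewrite IH (evalN_agree ag ec) (evalN_agree ag ee) mulSnr addnA.
by apply: sub_all ec => x; rewrite !inE !negb_or => /and3P[_ -> ->].
Qed.

Lemma sizes_spec s : let s' := den pSizes s in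
  [/\ ints s' 3 0 = (16 * ints s 0 0 + 1)%N,
      ints s' 4 0 = (32 * (ints s 0 2 * ints s 0 0 + 1))%N &
      ints s' 5 0 = (ints s 0 0 * ints s 0 1 + 1)%N].
Proof.
rewrite /= /pSizes !denE; set f1 := PFor 20 nN (3 +=N _); set f2 := PFor 20 nM _; set f3 := PFor 20 nN (PFor _ _ _).
set u1 := setN s _ _ _; set v1 := den f1 u1; set u2 := setN v1 _ _ _; set v2 := den f2 u2.
set u3 := setN v2 _ _ _; split.
- rewrite (den_ints f3) // -[LHS]/(ints v2 3 0) (den_ints f2) // -[LHS]/(ints v1 3 0).
  rewrite add_loop // /u1; simp; lia.
- rewrite (den_ints f3) // -[LHS]/(ints v2 4 0) /v2 add_loop2 //.
  have e : ints u2 0 = ints s 0 by rewrite -[LHS]/(ints v1 0) (den_ints f1).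
  rewrite -[evalN u2 nM]/(ints u2 0 2) -[evalN u2 nN]/(ints u2 0 0) e.
  rewrite -[ints u2 4 0]/32%N -[evalN u2 _]/32%N; lia.
- rewrite add_loop2 //.
  have e : ints u3 0 = ints s 0.
    by rewrite -[LHS]/(ints v2 0) (den_ints f2) // -[LHS]/(ints v1 0) (den_ints f1).
  rewrite -[evalN u3 nN]/(ints u3 0 0) -[evalN u3 nF]/(ints u3 0 1) e.
  rewrite -[ints u3 5 0]/1%N -[evalN u3 _]/1%N; lia.
Qed.

(** Doubling for X = [ints s 4 0] rounds suffices: either the power has passed X, or the exponent
    has grown in each round, and 2^X > X. The upper bound on 2^l keeps the number of tuples under
    control. *)
Lemma log_spec s : (0 < ints s 4 0)%N -> exists l,
  [/\ ints (den pLog s) 6 0 = (ints s 0 4 * l)%N, (0 < l)%N,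
      (ints s 4 0 <= 2 ^ l)%N & (2 ^ l <= 2 * ints s 4 0)%N].
Proof.
move=> X0; rewrite /pLog !denE; set f := PFor 20 (VN 4) _; set g := PFor 20 nK _.
set u := setN _ 14 _ _; set v := den f u; set X := ints s 4 0 in X0 *.
suff [h1 [h2 [h3|h3]]] : ints v 13 0 = (2 ^ ints v 14 0)%N /\ ((2 ^ ints v 14 0 <= 2 * X)%N /\
    ((X < 2 ^ ints v 14 0)%N \/ (X <= ints v 14 0)%N)).
- exists (ints v 14 0); split=> //; [|by case: (ints v 14 0) h3 => //; lia|exact: ltnW].
  by rewrite add_loop // -[LHS]/(ints v 0 4 * ints v 14 0)%N /v (den_ints f _ 0%N).
- exists (ints v 14 0); split=> //; [|by lia|by apply: leq_trans h3 (ltnW (ltn_expl _ _))].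
  by rewrite add_loop // -[LHS]/(ints v 0 4 * ints v 14 0)%N /v (den_ints f _ 0%N).
apply: (@for_invE _ X _ _ _ _ (fun j t => ints t 13 0 = (2 ^ ints t 14 0)%N /\
   ((2 ^ ints t 14 0 <= 2 * X)%N /\
    ((X < 2 ^ ints t 14 0)%N \/ (j <= ints t 14 0)%N)))) => //.
  by simp; rewrite expn0; split=> //; split; [lia|right].
move=> j t jX ij [aN aR] [IH1 [IH2 IH3]].
have e4 : ints t 4 0 = X by rewrite (aN 4 isT).
rewrite denE /= e4; case: ifP => c; rewrite ?denE; simp; rewrite ?IH1 ?addn1 ?expnS.
  rewrite IH1 in c; split; first by lia.
  by split; [lia|case: IH3 => h; [left; lia|right; lia]].
by split=> //; split=> //; left; rewrite -IH1 ltnNge c.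
Qed.

Lemma square_spec s : ints (den pSquare s) 7 0 = (ints s 6 0 * ints s 6 0)%N.
Proof. by rewrite /pSquare denE denE add_loop2 //=; simp; lia. Qed.

Lemma power_spec s : ints (den pPower s) 8 0 = (ints s 7 0 ^ ints s 0 4)%N.
Proof.
rewrite /pPower denE denE.
apply: (@for_invE _ _ _ _ _ _ (fun j t => ints t 8 0 = (ints s 7 0 ^ j)%N)) => //.
move=> j t jX ij [aN aR] IH.
have e7 : ints t 7 0 = ints s 7 0 by rewrite (aN 7 isT).
rewrite !denE; simp; rewrite add_loop //=; simp.
by rewrite add0n e7 IH expnS.
Qed.

End Setup.

(** * Running time *)

Fixpoint psize (p : prog) : nat :=
  match p with
  | PSeq p q => psize p + psize q
  | PIf _ p q => (psize p + psize q).+1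
  | PFor _ _ p => psize p + 2
  | _ => 1
  end.

(* Only the loops bounded by integer array 8 are superpolynomial. *)
Definition is_outer (e : nexp) := if e is NGet 8 (NConst 0) then true else false.

(** Nesting depth of one kind of loops: [true] counts those over the number of tuples, [false] all
    others. *)
Fixpoint depth (outer : bool) (p : prog) : nat :=
  match p with
  | PSeq p q | PIf _ p q => maxn (depth outer p) (depth outer q)
  | PFor _ e p => (is_outer e == outer) + depth outer p
  | _ => 0
  end.

Definition simple_bound (e : nexp) : bool :=
  if e is NGet a (NConst c)
  then ((a == 0) && (c < 5) || (c == 0) && (a \in [:: 3; 4; 5; 6; 7; 8]))%N
  else false.

Fixpoint simple_bounds (p : prog) : bool :=
  match p with
  | PSeq p q | PIf _ p q => simple_bounds p && simple_bounds q
  | PFor _ e p => simple_bound e && simple_bounds p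
  | _ => true
  end.

Definition bounded (R : realType) (s : state R) (M E : nat) :=
  [/\ (forall c, (c < 5)%N -> (ints s 0 c < M)%N),
      (forall a, a \in [:: 3; 4; 5; 6; 7]%N -> (ints s a 0 < M)%N) & (ints s 8 0 < E)%N].

Lemma cost_le (R : realType) (s : state R) M E p : bounded s M E -> simple_bounds p ->
  (cost_bound s p <= psize p * (M ^ depth false p * E ^ depth true p))%N.
Proof.
move=> [b0 b1 b8].
have M0 : (0 < M)%N by apply: leq_ltn_trans (b0 0%N isT).
have E0 : (0 < E)%N by apply: leq_ltn_trans b8.
have mono a b c d : (a <= b)%N -> (c <= d)%N -> (M ^ a * E ^ c <= M ^ b * E ^ d)%N.
  by move=> ab cd; apply: leq_mul; rewrite leq_pexp2l.
elim: p => [|a i e|a i e|p IHp q IHq|b p IHp q IHq|i e p IH] //=.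
- by move=> /andP[/IHp hp /IHq hq]; rewrite mulnDl; apply: leq_add;
  [apply: leq_trans hp _|apply: leq_trans hq _]; rewrite leq_mul2l mono ?orbT ?leq_maxl ?leq_maxr.
- move=> /andP[/IHp hp /IHq hq]; rewrite mulSn -[X in (X <= _)%N]add1n leq_add //.
    by rewrite muln_gt0 !expn_gt0 M0 E0.
  by rewrite mulnDl; apply: leq_add;
  [apply: leq_trans hp _|apply: leq_trans hq _]; rewrite leq_mul2l mono ?orbT ?leq_maxl ?leq_maxr.
move=> /andP[he /IH {}IH].
set A := (M ^ depth false p * E ^ depth true p)%N in IH.
have A0 : (0 < A)%N by rewrite muln_gt0 !expn_gt0 M0 E0.
(* The strict bound absorbs the loop overhead: e (c + 2) + 2 <= (e + 1) (c + 2). *)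
have step B : (evalN s e < B)%N ->
    (evalN s e * (cost_bound s p + 2) + 2 <= (psize p + 2) * (B * A))%N.
  move=> eB; apply: (@leq_trans (B * (cost_bound s p + 2))).
    by apply: (@leq_trans ((evalN s e).+1 * (cost_bound s p + 2)));
      [rewrite mulSn; lia|rewrite leq_mul2r eB orbT].
  by rewrite mulnCA leq_mul2l mulnDl; apply/orP; right; apply: leq_add => //; lia.
move: he step; case: e => // a [] // c he step.
have [/eqP a8|a8] := boolP (a == 8).
  subst a; case: c he step => [|c] he step; last by [].
  by rewrite /= add0n add1n expnS [X in (_ <= _ * X)%N]mulnCA; exact: step.
have -> : is_outer (NGet a (NConst c)) = false by case: a a8 {he step} => [|[|[|[|[|[|[|[|[|a]]]]]]]]].
rewrite /= add0n add1n expnS -mulnA; apply: step => /=; move: he => /= /orP[].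
  by move=> /andP[/eqP -> /b0].
move=> /andP[/eqP ->]; rewrite !inE (negbTE a8) orbF => h; apply: b1.
by rewrite !inE.
Qed.

(** With q the integer part of l/j, one has l <= j (q + 1) <= j 2^q; raise this to the power j and
    use q j <= l. *)
Lemma expn_le_exp2 l j : (0 < j)%N -> (l ^ j <= j ^ j * 2 ^ l)%N.
Proof.
move=> j0; set q := (l %/ j)%N.
have lq : (l <= j * 2 ^ q)%N.
  apply: (@leq_trans (j * q.+1)); first by rewrite mulnC; apply/ltnW/ltn_ceil.
  by rewrite leq_mul2l ltn_expl ?orbT.
apply: (@leq_trans ((j * 2 ^ q) ^ j)); first by rewrite leq_exp2r.
by rewrite expnMn -expnM leq_mul2l leq_pexp2l ?orbT // leq_trunc_div.
Qed.


(** * Analysis of the algorithm *)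

Definition pSearch z : prog := pTable z ;; pMain.

(** Each phase computes loop bounds of later ones, which [wf] forbids within one program; hence five
    well-formed programs composed as commands. *)
Definition algo z : cmd :=
  CSeq (compile pSizes) (CSeq (compile pLog) (CSeq (compile pSquare)
    (CSeq (compile pPower) (compile (pSearch z))))).

Definition exponent z := (depth false pSizes + depth false pLog + depth false pSquare +
  depth false pPower + depth false (pSearch z))%N.

Definition total_size z :=
  (psize pSizes + psize pLog + psize pSquare + psize pPower + psize (pSearch z))%N.

Section Run.
Variable R : realType.
Implicit Types s : state R.
Variables (s : state R) (z : nat).
Local Notation n := (ints s 0 0).
Local Notation F := (ints s 0 1).
Local Notation m := (ints s 0 2).
Local Notation d := (ints s 0 3).
Local Notation k := (ints s 0 4).

Hypothesis zero : forall a, (2 < a)%N -> ints s a 0 = 0%N.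
Hypothesis wt_ge0 : forall p, 0 <= reals s 2 p.
Hypothesis table_ge0 : forall c, 0 <= reals s 3 c.
Hypothesis k_gt0 : (0 < k)%N.
Hypothesis k_le : (k <= F)%N.

Definition wsize := (m + n + d + F + 1)%N.
(** Dominates T = k l, because l < 2^l <= 64(mn + 1) <= 128 W^2 with W = [wsize], and k <= W. Only
    T^2 needs the square of [qsize], which is then used for all polynomial loops. *)
Definition qsize := (128 * wsize ^ 3)%N.

Lemma algo_run : exists t s' l CT BIG, [/\ exec (algo z) s t s',
  (t <= total_size z * ((qsize * qsize).+1 ^ exponent z *
     (((k * l) * (k * l)) ^ k).+1 ^ 2))%N,
  [/\ (0 < l)%N, (32 * (m * n + 1) <= 2 ^ l)%N & (2 ^ l <= 64 * (m * n + 1))%N],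
  (forall c, 0 <= CT c) /\ (forall p x, (p < n)%N -> (x < F)%N ->
    CT (p * F + x)%N = weighted (ints s 0) (reals s 0) (reals s 1) (reals s 2) z p x) &
  [/\ (forall p x, (p < n)%N -> (x < F)%N -> CT (p * F + x)%N <= BIG),
   best_inv (ints s 0) (ints s 1) CT s', ints s' 19 0 != 0%N &
   forall idx j, (idx < n * F + 1)%N -> (j < 16 * n + 1)%N ->
     explored (ints s 0) (ints s 1) (reals s 1) CT (k * l) BIG (reals s' 12 0) idx j]].
Proof.
set s1 := den pSizes s; set s2 := den pLog s1; set s3 := den pSquare s2.
set s4 := den pPower s3; set s5 := den (pTable z) s4.
have [a3 a4 a5] := sizes_spec s; rewrite -/s1 in a3 a4 a5.
have [|l [b6 l0 lX Xl]] := @log_spec _ s1; first by rewrite a4; lia.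
rewrite -/s2 a4 in b6 lX Xl.
have kept1 a : a \notin modN pSizes -> ints s1 a = ints s a by exact: den_ints.
have kept2 a : a \notin modN pLog -> ints s2 a = ints s1 a by exact: den_ints.
have kept3 a : a \notin modN pSquare -> ints s3 a = ints s2 a by exact: den_ints.
have kept4 a : a \notin modN pPower -> ints s4 a = ints s3 a by exact: den_ints.
have kept5 a : a \notin modN (pTable z) -> ints s5 a = ints s4 a by exact: den_ints.
have R4 a : reals s4 a = reals s a.
  by rewrite /s4 (den_reals pPower) // /s3 (den_reals pSquare) // /s2 (den_reals pLog) //
     /s1 (den_reals pSizes).
rewrite kept1 // in b6.
have c7 : ints s3 7 0 = ((k * l) * (k * l))%N by rewrite /s3 square_spec b6.
have e8 : ints s4 8 0 = (((k * l) * (k * l)) ^ k)%N.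
  by rewrite /s4 power_spec c7 kept3 // kept2 // kept1.
set T := (k * l)%N in b6 c7 e8 *.
have z4 : ints s4 0 = ints s 0 by rewrite kept4 // kept3 // kept2 // kept1.
have [t1 t2 [t3 t6]] := table_spec wt_ge0 z z4 (R4 0%N) (R4 1%N) (R4 2).
rewrite -/s5 R4 in t1 t2 t3 t6.
have cx : ctx (ints s 0) (ints s 1) (reals s 1) (reals s5 3) (16 * n + 1) (n * F + 1) T
    (reals s5 10 0) s5.
  split.
  - by rewrite kept5 // z4.
  - by rewrite kept5 // kept4 // kept3 // kept2 // kept1.
  - by rewrite /s5 (den_reals (pTable z)).
  - by [].
  split.
  - by rewrite kept5 // kept4 // kept3 // kept2 // a3.
  - by rewrite kept5 // kept4 // kept3 // kept2 // a5.
  - by rewrite kept5 // kept4 // kept3 // b6.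
  - by rewrite kept5 // kept4 // c7.
  by split=> //; rewrite kept5 // e8.
have T0 : (0 < T)%N by rewrite muln_gt0 k_gt0.
have big p x : (p < n)%N -> (x < F)%N -> reals s5 3 (p * F + x)%N <= reals s5 10 0.
  by move=> pn xF; rewrite t2 //; exact: t3.
have [] := main_spec T0 k_gt0 k_le big cx; [by rewrite addn1|by rewrite addn1|].
set s6 := den pMain s5 => m1 m2 m3.
set Q := qsize; set W := wsize.
have W0 : (0 < W)%N by rewrite /W /wsize addn1.
have [nW FW mW dW] : [/\ n <= W, F <= W, m <= W & d <= W]%N.
  by rewrite /W /wsize; split; lia.
have QE : Q = (128 * (W * (W * W)))%N by rewrite /Q /qsize -/W !expnS expn0 muln1.
have W23 : (W * W <= W * (W * W))%N by rewrite leq_pmull.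
have W13 : (W <= W * W)%N by rewrite leq_pmulr.
have mn : (m * n + 1 <= 2 * (W * W))%N.
  by have := leq_mul mW nW; have := leq_mul W0 W0; lia.
have TQ : (T <= Q)%N.
  have := leq_mul (leq_trans k_le FW) (leq_trans (ltnW (ltn_expl l (isT : 1 < 2)%N)) Xl).
  rewrite QE /T; have := leq_mul (leqnn W) mn; lia.
have Q1 : (Q <= Q * Q)%N by rewrite leq_pmulr // QE !muln_gt0 W0.
have nF := leq_mul nW FW.
have TTQ : (T * T <= Q * Q)%N by apply: (leq_mul TQ TQ).
have bd t : (forall c, (c < 5)%N -> (ints t 0 c <= Q)%N) -> (ints t 3 0 <= Q)%N ->
    (ints t 4 0 <= Q)%N -> (ints t 5 0 <= Q)%N -> (ints t 6 0 <= Q)%N ->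
    (ints t 7 0 <= Q * Q)%N -> (ints t 8 0 <= (T * T) ^ k)%N ->
    bounded t (Q * Q).+1 (((T * T) ^ k).+1).
  move=> h0 h3 h4 h5 h6 h7 h8; split.
  - by move=> c /h0 h; rewrite ltnS (leq_trans h).
  - move=> a; rewrite !inE => /or4P[/eqP->|/eqP->|/eqP->|/orP[]/eqP->];
      by rewrite ltnS // (leq_trans _ Q1).
  - by rewrite ltnS.
have s0 c : (c < 5)%N -> (ints s 0 c <= Q)%N.
  case: c => [|[|[|[|[|//]]]]] _; rewrite QE; lia.
have E0 : (0 < (T * T) ^ k)%N by rewrite expn_gt0 muln_gt0 T0.
have z3 a : (2 < a)%N -> (ints s a 0 <= Q)%N by move=> /zero ->.
have B0 : bounded s (Q * Q).+1 (((T * T) ^ k).+1).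
  by apply: bd => //; rewrite ?zero.
have [z4' z5 z6 z7 z8] : [/\ ints s 4 0 = 0, ints s 5 0 = 0, ints s 6 0 = 0, ints s 7 0 = 0 & ints s 8 0 = 0]%N.
  by split; exact: zero.
have B1 : bounded s1 (Q * Q).+1 (((T * T) ^ k).+1).
  apply: bd; rewrite ?a3 ?a4 ?a5 ?kept1 ?z6 ?z7 ?z8 //; rewrite QE; lia.
have B2 : bounded s2 (Q * Q).+1 (((T * T) ^ k).+1).
  apply: bd; rewrite ?b6 // ?kept2 // ?a3 ?a4 ?a5 ?kept1 // ?z6 ?z7 ?z8 //; rewrite QE; lia.
have B3 : bounded s3 (Q * Q).+1 (((T * T) ^ k).+1).
  apply: bd; rewrite ?c7 ?TTQ // ?kept3 // ?b6 // ?kept2 // ?a3 ?a4 ?a5 ?kept1 // ?z6 ?z7 ?z8 //; rewrite QE; lia.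
have B4 : bounded s4 (Q * Q).+1 (((T * T) ^ k).+1).
  apply: bd; rewrite ?e8 // ?kept4 // ?c7 ?TTQ // ?kept3 // ?b6 // ?kept2 // ?a3 ?a4 ?a5 ?kept1 // ?z6 ?z7 ?z8 //; rewrite QE; lia.
have [u1 x1 y1] := exec_wf s (isT : wf pSizes).
have [u2 x2 y2] := exec_wf s1 (isT : wf pLog).
have [u3 x3 y3] := exec_wf s2 (isT : wf pSquare).
have [u4 x4 y4] := exec_wf s3 (isT : wf pPower).
have [u5 x5 y5] := exec_wf s4 (isT : wf (pSearch z)).
have s56 : den (pSearch z) s4 = s6 by rewrite /pSearch denE.
rewrite s56 in x5.
have CL p t a : bounded t (Q * Q).+1 (((T * T) ^ k).+1) -> simple_bounds p ->
    (depth false p <= exponent z)%N -> (depth true p <= 2)%N -> (a <= cost_bound t p)%N ->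
    (a <= psize p * ((Q * Q).+1 ^ exponent z * ((T * T) ^ k).+1 ^ 2))%N.
  move=> bt sp d1 d2 ac; apply: (leq_trans ac); apply: leq_trans (cost_le bt sp) _.
  by rewrite leq_mul2l leq_mul ?orbT // leq_pexp2l.
have [d1 d2 d3 d4 d5] : [/\ depth false pSizes <= exponent z, depth false pLog <= exponent z,
    depth false pSquare <= exponent z, depth false pPower <= exponent z &
    depth false (pSearch z) <= exponent z]%N.
  rewrite /exponent; move: (depth false pSizes) (depth false pLog) (depth false pSquare).
  move: (depth false pPower) (depth false (pSearch z)) => e5 e4 e1 e2 e3.
  by split; lia.
exists (u1 + (u2 + (u3 + (u4 + u5))))%N, s6, l, (reals s5 3), (reals s5 10 0); split=> //.
- apply: ExecSeq x1 _; apply: ExecSeq x2 _; apply: ExecSeq x3 _; exact: ExecSeq x4 x5.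
- move: (CL _ pSizes _ _ B0 isT d1 isT y1) (CL _ pLog _ _ B1 isT d2 isT y2) (CL _ pSquare _ _ B2 isT d3 isT y3).
  move: (CL _ pPower _ _ B3 isT d4 isT y4) (CL _ (pSearch z) _ _ B4 isT d5 isT y5); rewrite /total_size -/T -/Q.
  set K := ((Q * Q).+1 ^ exponent z * _)%N; move: K (psize pSizes) (psize pLog) (psize pSquare) (psize pPower) (psize (pSearch z)).
  by move=> K q1 q2 q3 q4 q5 h4 h5 h1 h2 h3; rewrite !mulnDl; lia.
- by split=> //; lia.
- by split=> //; exact: t6.
Qed.

End Run.


(** The power l^(2k) is traded for (2k)^(2k) 2^l, and 2^l is polynomial in the input size. *)
Lemma tuples_le (b k l W : nat) : (0 < k)%N -> (2 ^ l <= b * W ^ 2)%N ->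
  (((k * l) * (k * l)) ^ k <= 2 ^ (2 * k) * k ^ (4 * k) * (b * W ^ 2))%N.
Proof.
move=> k0 lW.
have -> : (((k * l) * (k * l)) ^ k = k ^ (2 * k) * l ^ (2 * k))%N.
  by rewrite mulnn -expnM expnMn.
apply: (@leq_trans (k ^ (2 * k) * ((2 * k) ^ (2 * k) * 2 ^ l))).
  by rewrite leq_mul2l expn_le_exp2 ?orbT // muln_gt0.
rewrite expnMn -!mulnA mulnCA leq_mul2l; apply/orP; right.
rewrite (_ : 4 * k = 2 * k + 2 * k)%N; last by lia.
by rewrite expnD -!mulnA !leq_mul2l lW !orbT.
Qed.

Lemma steps_le (C0 D b k l W t : nat) : (0 < k)%N -> (0 < W)%N -> (0 < b)%N -> (0 < l)%N ->
  (2 ^ l <= b * W ^ 2)%N ->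
  (t <= C0 * (((b * W ^ 3) * (b * W ^ 3)).+1 ^ D * (((k * l) * (k * l)) ^ k).+1 ^ 2))%N ->
  (t <= (C0 * (2 * b ^ 2) ^ D * (2 ^ 6 * b ^ 2)) * W ^ (6 * D + 4) * k ^ (12 * k))%N.
Proof.
move=> k0 W0 b0 l0 lW tle.
have step1 : (((b * W ^ 3) * (b * W ^ 3)).+1 ^ D <= (2 * b ^ 2) ^ D * W ^ (6 * D))%N.
  rewrite expnM -expnMn; have [->//|D0] := posnP D; rewrite leq_exp2r //.
  have -> : (2 * b ^ 2 * W ^ 6 = 2 * ((b * W ^ 3) * (b * W ^ 3)))%N.
    by rewrite mulnn expnMn -expnM mulnA.
  have : (0 < b * W ^ 3)%N by rewrite muln_gt0 b0 expn_gt0 W0.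
  by move: (b * W ^ 3)%N => x x0; have := leq_mul x0 x0; lia.
have step2 : ((((k * l) * (k * l)) ^ k).+1 ^ 2 <= 2 ^ 6 * b ^ 2 * W ^ 4 * k ^ (12 * k))%N.
  have E0 : (0 < ((k * l) * (k * l)) ^ k)%N by rewrite expn_gt0 !muln_gt0 k0 l0.
  have := tuples_le k0 lW; set E := (_ ^ k)%N in E0 * => EB.
  apply: (@leq_trans ((2 * (2 ^ (2 * k) * k ^ (4 * k) * (b * W ^ 2))) ^ 2)).
    by rewrite leq_exp2r //; apply: (@leq_trans (2 * E)); [lia|rewrite leq_mul2l EB].
  (* The constant 2^4 is there for k = 1; from k = 2 on, 2 <= k is enough. Together with k^(8k) this
     yields the exponent 12k. *)
  have k4 : (2 ^ (4 * k) <= 2 ^ 4 * k ^ (4 * k))%N.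
    have [k1|k1] := leqP k 1.
      have -> : k = 1%N by lia.
      by rewrite exp1n muln1.
    apply: (@leq_trans (k ^ (4 * k))); last by rewrite leq_pmull // expn_gt0.
    by rewrite leq_exp2r // muln_gt0.
  have e1 : ((2 * (2 ^ (2 * k) * k ^ (4 * k) * (b * W ^ 2))) ^ 2 =
      2 ^ (4 * k) * (2 ^ 2 * b ^ 2 * W ^ 4 * k ^ (8 * k)))%N.
    have ex : ((2 ^ (2 * k)) ^ 2 = 2 ^ (4 * k))%N by rewrite -expnM; congr (_ ^ _)%N; lia.
    have ey : ((k ^ (4 * k)) ^ 2 = k ^ (8 * k))%N by rewrite -expnM; congr (_ ^ _)%N; lia.
    by rewrite -ex -ey; move: (2 ^ _)%N (k ^ _)%N => x y; ring.
  have e2 : (2 ^ 6 * b ^ 2 * W ^ 4 * k ^ (12 * k) =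
      2 ^ 4 * k ^ (4 * k) * (2 ^ 2 * b ^ 2 * W ^ 4 * k ^ (8 * k)))%N.
    rewrite (_ : 12 * k = 4 * k + 8 * k)%N; last by lia.
    by rewrite expnD; move: (k ^ (4 * k))%N (k ^ (8 * k))%N (b ^ 2)%N (W ^ 4)%N => x y v w; ring.
  by rewrite e1 e2 leq_mul2r k4 orbT.
apply: (leq_trans tle).
rewrite (_ : C0 * (2 * b ^ 2) ^ D * (2 ^ 6 * b ^ 2) * W ^ (6 * D + 4) * k ^ (12 * k) =
  C0 * ((2 * b ^ 2) ^ D * W ^ (6 * D) * (2 ^ 6 * b ^ 2 * W ^ 4 * k ^ (12 * k))))%N.
  by rewrite leq_mul2l leq_mul ?orbT.
rewrite expnD; set x1 := (W ^ (6 * D))%N; set x2 := ((2 * b ^ 2) ^ D)%N.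
set x3 := (2 ^ 6)%N; move: x1 x2 x3 (W ^ 4)%N (b ^ 2)%N (k ^ _)%N => x1 x2 x3 w v y; ring.
Qed.

Lemma ln2_ge_half (R : realType) : 2^-1 <= ln (2 : R).
Proof.
have h : 2^-1 <= expR (- 2^-1 : R).
  by apply: le_trans (expR_ge1Dx _); lra.
have h2 : ln (2^-1 : R) <= - 2^-1.
  by rewrite -[leRHS]expRK ler_ln ?posrE ?expR_gt0 ?invr_gt0.
by move: h2; rewrite lnV ?posrE // lerN2.
Qed.

(** k^(12k) = exp (12 k ln k), and ln 2 >= 1/2 doubles 12 to 24. *)
Lemma pow_le_powR (R : realType) (k c : nat) : (0 < k)%N -> (24 <= c)%N ->
  (k ^ (12 * k))%:R <= (2 : R) `^ (c%:R * (k%:R * ln k%:R)).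
Proof.
move=> k0 c24; have K0 : 0 < k%:R :> R by rewrite ltr0n.
have lnk : 0 <= ln k%:R :> R by rewrite ln_ge0 // ler1n.
rewrite natrX -[X in X ^+ _](@lnK _ k%:R) ?posrE // -expRM_natl.
rewrite /powR pnatr_eq0 /= ler_expR.
have h := @ln2_ge_half R.
have c' : 24 <= c%:R :> R by rewrite ler_nat.
have kl : 0 <= k%:R * ln k%:R :> R by rewrite mulr_ge0.
rewrite natrM; apply: (@le_trans _ _ (24 * (k%:R * ln k%:R) * 2^-1)); first by lra.
by apply: ler_pM => //; [lra|lra|exact: ler_wpM2r].
Qed.

Lemma fpt_bound (R : realType) (K e : nat) : exists c e' : nat, forall k W t : nat,
  (0 < k)%N -> (0 < W)%N -> (t <= K * W ^ e * k ^ (12 * k))%N ->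
  t%:R <= (2 : R) `^ (c%:R * (k%:R * ln k%:R)) * (c * W ^ e')%:R.
Proof.
exists (24 + K)%N, e => k W t k0 W0 tle.
apply: (@le_trans _ _ ((K * W ^ e)%:R * (k ^ (12 * k))%:R)); first by rewrite -natrM ler_nat.
rewrite mulrC; apply: ler_pM => //; first by rewrite pow_le_powR // leq_addr.
by rewrite ler_nat leq_mul2r leq_addl orbT.
Qed.


(** Horner's scheme: whichever tuple of candidates the analysis singles out, its code has been
    enumerated. *)
Lemma digits_surj T k (c : nat -> nat) :
  (forall i, (i < k)%N -> (c i < T * T)%N) ->
  exists2 e, (e < (T * T) ^ k)%N & forall i, (i < k)%N -> dg T e i = c i.
Proof.
elim: k c => [|k IH] c ck; first by exists 0%N.
have [e eE eP] := IH (fun i => c i.+1) (fun i ik => ck i.+1 ik).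
have c0 := ck 0%N isT; have T0 : (0 < T * T)%N by apply: leq_ltn_trans c0.
exists (e * (T * T) + c 0)%N.
  rewrite expnS [X in (_ < X)%N]mulnC; apply: (@leq_trans (e.+1 * (T * T))); first by rewrite mulSn; lia.
  by rewrite leq_mul2r eE orbT.
case=> [|i] ik; rewrite /dg; first by rewrite expn0 divn1 modnMDl modn_small.
by rewrite expnS divnMA divnMDl // (divn_small c0) addn0; exact: eP.
Qed.

(** * Replacing an optimal center by a candidate *)

Section Diag.
Variables (R : realType) (d : nat).
Implicit Types x f p : nat -> R.

Lemma dist_self x : dist d x x = 0.
Proof. by rewrite /dist /nrm /dot big1 ?sqrtr0 // => j _; rewrite subrr mulr0. Qed.

Lemma off_mid_diag x f : off_mid d x x f = 2 * dist d f x.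
Proof.
apply: (@pexpIrn _ 2); rewrite ?nnegrE ?mulr_ge0 ?dist_ge0 //.
have := off_mid_parallelogram d x x f; rewrite (distC d x f).
rewrite dist_self exprMn; lra.
Qed.

(* Either the facility nearest to the midpoint of two elements of [L] replaces
   [o], or the element of [L] nearest to [o] does. *)
Lemma candidate_near (T F : nat) (L : seq nat) (M : nat -> nat) (fc : nat -> nat -> R)
    (o : nat) : (0 < T)%N -> (o < F)%N ->
  (forall a, (a < T)%N -> (nth 0%N L a < F)%N) ->
  (forall a b, (a < T)%N -> (b < T)%N -> (M (a * T + b) < F)%N /\ forall y, (y < F)%N ->
     off_mid d (fc (nth 0%N L a)) (fc (nth 0%N L b)) (fc (M (a * T + b)%N))
     <= off_mid d (fc (nth 0%N L a)) (fc (nth 0%N L b)) (fc y)) ->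
  exists c, [/\ (c < T * T)%N, (M c < F)%N & forall p b, (b < T)%N ->
    dist d p (fc (M c)) <= 11 / 6 * dist d p (fc o) + dist d p (fc (nth 0%N L b))].
Proof.
move=> T0 oF LF near; pose l a := fc (nth 0%N L a).
have idx a b : (a < T)%N -> (b < T)%N -> (a * T + b < T * T)%N.
  move=> aT bT; apply: (@leq_trans (a.+1 * T)); first by rewrite mulSn; lia.
  by rewrite leq_mul2r aT orbT.
have [a _ amin] := @arg_minP _ _ _ (Ordinal T0) xpredT (fun a : 'I_T => dist d (l a) (fc o)) isT.
have aT := ltn_ord a.
have [/existsP[b bo]|] := boolP [exists b : 'I_T, off_mid d (l a) (l b) (fc o) <=
    4 / 5 * dist d (l a) (fc o)].
  have [Mab nab] := near _ _ aT (ltn_ord b).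
  exists (a * T + b)%N; split=> // [|p c cT]; first exact: idx.
  apply: (near_midpoint p bo (nab _ oF)).
  exact: (amin (Ordinal cT) isT).
rewrite negb_exists => /forallP nob.
(* On the diagonal, the midpoint is the element of [L] itself, so the candidate lies at distance 0
   from it. *)
have [Maa naa] := near _ _ aT aT.
exists (a * T + a)%N; split=> // [|p b bT]; first exact: idx.
have f0 : dist d (fc (M (a * T + a)%N)) (l a) = 0.
  have := naa _ (LF _ aT); rewrite !off_mid_diag dist_self mulr0.
  by have := dist_ge0 d (fc (M (a * T + a)%N)) (l a); rewrite /l; lra.
have := dist_triangle d p (l a) (fc (M (a * T + a)%N)).
rewrite (distC d (l a)) f0 addr0 => h; apply: (le_trans h).
apply: far_from_midpoint; first exact: (amin (Ordinal bT) isT).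
by apply: ltW; rewrite ltNge; exact: (nob (Ordinal bT)).
Qed.

End Diag.

(** * Approximation factor and running time on instances *)

Section Main.
Variables (R : realType) (I : instance R) (z : nat).
Hypothesis z_gt0 : (0 < z)%N.
Local Notation n := (npts I).
Local Notation F := (nfac I).
Local Notation m := (ngrp I).
Local Notation d := (Defs.dim I).
Local Notation k := (ncen I).
Local Notation s := (input I).
Local Notation pt' := (fun p j => reals s 0 (p * d + j)%N).
Local Notation fc' := (fun x j => reals s 1 (x * d + j)%N).
Local Notation W := (weighted (ints s 0) (reals s 0) (reals s 1) (reals s 2) z).
Local Notation incf := (fun i p => (0 < ints s 1 (i * n + p))%N).

Lemma input_grp (i : 'I_m) (p : 'I_n) : incf i p = (p \in @grp R I i).
Proof. by rewrite /= rowmajorE; case: (_ \in _). Qed.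

Lemma input_dist (p : 'I_n) (x : 'I_F) : dist d (pt' p) (fc' x) = edist (pt p) (fac x).
Proof.
rewrite /dist /nrm /dot /edist big_mkord; congr Num.sqrt; apply: eq_bigr => j _.
by rewrite /= !rowmajorE expr2.
Qed.

Lemma input_wt (p : 'I_n) : reals s 2 p = wt p.
Proof. by rewrite /= (nth_map p) ?size_enum_ord // nth_ord_enum. Qed.

Lemma input_wt_ge0 p : 0 <= reals s 2 p.
Proof.
rewrite /=; have [pn|pn] := ltnP p n.
  by have := input_wt (Ordinal pn) => /= ->; exact: wt_ge0.
by rewrite nth_default // size_map size_enum_ord.
Qed.

Lemma input_weighted (p : 'I_n) (x : 'I_F) : W p x = wt p * edist (pt p) (fac x) ^+ z.
Proof. by rewrite /weighted input_wt -input_dist. Qed.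

Lemma gsum_grp (phi : nat -> R) (i : 'I_m) : gsum n incf phi i = \sum_(p in @grp R I i) phi (p : nat).
Proof. by rewrite /gsum big_mkord; apply: eq_bigl => p; exact: input_grp. Qed.

Lemma input_cover p : (p < n)%N -> exists2 i, (i < m)%N & incf i p.
Proof.
move=> pn; have : Ordinal pn \in \bigcup_(i < m) @grp R I i by rewrite grp_cover inE.
case/bigcupP => i _ ip; exists i => //.
by rewrite -[p]/(val (Ordinal pn)) input_grp.
Qed.

Lemma edist_ge0 (x y : 'rV[R]_d) : 0 <= edist x y.
Proof. exact: sqrtr_ge0. Qed.

Lemma cost_le_maxsum (X : {set 'I_F}) psi : (0 < #|X|)%N ->
  (forall p : 'I_n, exists2 x, x \in X & W p x <= psi (p : nat)) ->
  cost z X <= maxsum n m incf psi.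
Proof.
move=> X0 cov; rewrite /cost; apply: bigmax_le => [|i _]; first exact: maxsum_ge0.
apply: le_trans (gsum_le_maxsum _ _ _ (ltn_ord i)); rewrite gsum_grp; apply: ler_sum => p _.
have [x xX xp] := cov p; apply: le_trans xp; rewrite input_weighted.
have [y yX [-> ymin]] := dist_to_attained p X0.
by apply: ler_wpM2l; [exact: wt_ge0|apply: lerXn2r; rewrite ?nnegrE ?edist_ge0 ?ymin].
Qed.

Lemma opt_witness : exists (op : nat -> nat) (Xs : seq nat),
  [/\ size Xs = k, all (fun x => (x < F)%N) Xs,
    (forall p, (p < n)%N -> op p \in Xs), 0 <= opt I z &
    forall i, (i < m)%N -> gsum n incf (fun p => W p (op p)) i <= opt I z].
Proof.
have [X Xk [oX _]] := opt_attained I z.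
have X0 : (0 < #|X|)%N by rewrite Xk ncen_gt0.
have ex (p : nat) : exists x : nat, forall pn : (p < n)%N,
    x \in map val (enum X) /\ W p x = wt (Ordinal pn) * dist_to X (Ordinal pn) ^+ z.
  have [pn|npn] := pselect (p < n)%N; last by exists 0%N => pn; case: npn.
  have [x xX [dx _]] := dist_to_attained (Ordinal pn) X0.
  exists x => pn'; rewrite (bool_irrelevance pn' pn); split.
    by rewrite map_f // mem_enum.
  by rewrite dx -input_weighted.
have [op opP] := choice ex.
exists op, (map val (enum X)); split.
- by rewrite size_map -cardE.
- by apply/allP => _ /mapP[x _ ->]; exact: ltn_ord.
- by move=> p pn; case: (opP p pn).
- rewrite oX /cost; elim/big_rec: _ => // i x _ x0; by rewrite le_max x0 orbT.
move=> i im; rewrite -[i]/(val (Ordinal im)) gsum_grp oX.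
rewrite (eq_bigr (fun p => wt p * dist_to X p ^+ z)).
  by rewrite /cost (le_bigmax _ _ (Ordinal im)).
move=> p _; have [_ ->] := opP p (ltn_ord p).
by rewrite (_ : Ordinal _ = p) //; exact: val_inj.
Qed.

(** One factor 17/16 comes from the guess and one from the greedy excess. The sum 11/6 + (17/16)^2
    is below 297/100 = 3 (1 - 1/100), and (17/6)^(z-1) <= 3^(z-1) does the rest. *)
Lemma combine_bound (op : nat -> nat) psi i : 
  gsum n incf (fun p => W p (op p)) i <= opt I z ->
  gsum n incf psi i <= (17 / 16) ^+ 2 * opt I z -> 0 <= opt I z ->
  gsum n incf (fun p => (17 / 6) ^+ z.-1 * (11 / 6 * W p (op p) + psi p)) i
    <= 3 ^+ z * (1 - 1 / 100) * opt I z.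
Proof.
rewrite /gsum => h1 h2 O0; rewrite -big_distrr big_split -big_distrr /=.
rewrite -{1 3}(prednK z_gt0) [in leRHS]exprS.
have e : (17 / 6 : R) ^+ z.-1 <= 3 ^+ z.-1 by apply: lerXn2r; rewrite ?nnegrE; lra.
have e0 : 0 <= (17 / 6 : R) ^+ z.-1 by rewrite exprn_ge0 //; lra.
apply: (@le_trans _ _ ((17 / 6) ^+ z.-1 * (297 / 100 * opt I z))).
  by apply: ler_wpM2l => //; lra.
apply: (@le_trans _ _ (3 ^+ z.-1 * (297 / 100 * opt I z))).
  by apply: ler_wpM2r => //; lra.
by rewrite le_eqVlt; apply/orP; left; apply/eqP; field.
Qed.

Lemma approx_bound (b : R) l CT BIG :
  (0 < l)%N -> (32 * (m * n + 1) <= 2 ^ l)%N -> (forall c, 0 <= CT c) ->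
  (forall p x, (p < n)%N -> (x < F)%N -> CT (p * F + x)%N = W p x) ->
  (forall idx j, (idx < n * F + 1)%N -> (j < 16 * n + 1)%N ->
     explored (ints s 0) (ints s 1) (reals s 1) CT (k * l) BIG b idx j) ->
  b <= 3 ^+ z * (1 - 1 / 100) * opt I z.
Proof.
move=> l0 lmn CT0 CTW expl.
have [op [Xs [sX XF opX O0 opO]]] := opt_witness.
pose C p x := CT (p * F + x)%N; pose T := (k * l)%N.
have T0 : (0 < T)%N by rewrite muln_gt0 ncen_gt0.
have C0 p x : 0 <= C p x by exact: CT0.
have opF p : (p < n)%N -> (op p < F)%N by move=> /opX; exact: (allP XF).
have opO' i : (i < m)%N -> gsum n incf (fun p => C p (op p)) i <= opt I z.
  move=> im; rewrite (eq_gsum _ (psi := fun p => W p (op p))); first exact: opO.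
  by move=> p pn; apply: CTW => //; exact: opF.
have X0 : (0 < size Xs)%N by rewrite sX ncen_gt0.
have lmn' : (32 * (m * n) <= 2 ^ l)%N by apply: leq_trans lmn; lia.
have CTP p x : (p < n)%N -> (x < F)%N -> exists2 idx, (idx < n * F + 1)%N & CT idx = C p x.
  move=> pn xF; exists (p * F + x)%N => //.
  by have := leq_mul2r F p.+1 n; rewrite pn orbT mulSn; lia.
have N0 : (0 < n * F + 1)%N by rewrite addn1.
have [idx [j [iN jn H]]] :=
  guess_cover C0 input_cover opX opO' O0 XF X0 lmn' l0 N0 CTP.
have [|L [M [gr sL near be]]] := expl idx j iN; first by rewrite addn1.
have [|psi psiO psiL] := H L gr; first by rewrite sL sX.
have LF a : (a < T)%N -> (nth 0%N L a < F)%N.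
  by move=> aT; apply: (greedy_lt gr); apply: mem_nth; rewrite sL.
have ex (i : nat) : exists c, (i < k)%N -> [/\ (c < T * T)%N, (M c < F)%N &
    forall p b, (b < T)%N -> dist d p (fc' (M c)) <=
      11 / 6 * dist d p (fc' (nth 0%N Xs i)) + dist d p (fc' (nth 0%N L b))].
  have [ik|ik] := ltnP i k; last by exists 0%N.
  have oF : (nth 0%N Xs i < F)%N by apply: (allP XF); apply: mem_nth; rewrite sX.
  by have [c cP] := candidate_near (fc := fc') T0 oF LF near; exists c.
have [cf cfP] := choice ex.
have [|e eE eP] := @digits_surj T k cf; first by move=> i /cfP[].
apply: le_trans (be e eE) _; apply: maxsum_le.
  by rewrite !mulr_ge0 ?exprn_ge0 //; lra.
move=> i im; apply: le_trans (combine_bound (opO i im) (psiO i im) O0).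
apply: gsum_le => p pn.
have [x xL xp] := psiL p pn.
have ik : (index (op p) Xs < k)%N by rewrite -sX index_mem opX.
have [cT cF cd] := cfP _ ik.
have yC : M (cf (index (op p) Xs)) \in centers T M e k.
  by apply/mapP; exists (index (op p) Xs); rewrite ?mem_iota ?eP.
apply: le_trans (relaxs_le C BIG p yC) _; rewrite /C CTW //.
have ixT : (index x L < T)%N by rewrite -(sL : size L = T) index_mem.
(* The candidate belongs to the optimal center of [p]; its bound, valid for all of [L], is used at
   the element [x] that serves [p]. *)
have := cd (pt' p) _ ixT; rewrite !nth_index ?opX // => h.
have xF : (x < F)%N by exact: greedy_lt gr xL.
apply: (@le_trans _ _ ((17 / 6) ^+ z.-1 * (11 / 6 * W p (op p) + W p x))); last first.
  apply: ler_wpM2l; first by rewrite exprn_ge0 //; lra.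
  by rewrite lerD2l -CTW.
rewrite /weighted.
set w := reals s 2 p; have w0 : 0 <= w by exact: input_wt_ge0.
set a := dist d _ (fc' (op p)) in h *; set b' := dist d _ (fc' x) in h *.
have [a0 b0] : 0 <= a /\ 0 <= b' by split; exact: dist_ge0.
have := @power_mean R (11 / 6) 1 a b' z.-1; rewrite (prednK z_gt0) !mul1r.
rewrite (_ : 11 / 6 + 1 = 17 / 6 :> R); last by field.
move=> /(_ _ _ a0 b0) pm.
rewrite mulrCA -mulrDr [leRHS]mulrCA; apply: ler_wpM2l => //.
apply: le_trans (pm _ _) => //; last by lra.
by apply: lerXn2r; rewrite ?nnegrE ?dist_ge0 //; lra.
Qed.

End Main.

Lemma algo_approximates (R : realType) z : (0 < z)%N ->
  approximates (algo z) z (3 ^+ z * (1 - 1 / 100) : R).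
Proof.
move=> z0 I t s ex.
have zero a : (2 < a)%N -> ints (input I) a 0 = 0%N by case: a => [|[|[|]]].
have [t' [s' [l [CT [BIG [ex' _ [l0 lmn _] [CT0 CTW] [_ best have_ expl]]]]]]] :=
  algo_run z zero (@input_wt_ge0 R I) (fun c => lexx 0) (ncen_gt0 I) (ncen_le I).
(* The claim concerns any halting run, and determinism identifies it with the one constructed. *)
have [_ ->] := exec_det ex ex'.
have [ck [psi bE cov]] := best have_.
have card : #|output I s'| = ncen I.
  rewrite -sum1_card big_mkcond -[RHS]ck /cnt big_mkord; apply: eq_bigr => x _.
  by rewrite inE; case: (_ != _).
split=> //; apply: le_trans (approx_bound z0 l0 lmn CT0 CTW expl).
rewrite bE; apply: cost_le_maxsum; first by rewrite card ncen_gt0.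
move=> p; have [x [xF x0 xp]] := cov p (ltn_ord p).
by exists (Ordinal xF); rewrite ?inE // -CTW.
Qed.

Lemma algo_fpt_time (R : realType) z : @fpt_time R (algo z).
Proof.
have [c [e H]] := fpt_bound R (total_size z * (2 * 128 ^ 2) ^ exponent z * (2 ^ 6 * 128 ^ 2))
  (6 * exponent z + 4).
exists c, e => I; set W := (ngrp I + npts I + Defs.dim I + nfac I + 1)%N.
have W0 : (0 < W)%N by rewrite /W addn1.
have nW : (npts I <= W)%N by rewrite /W; lia.
have mW : (ngrp I <= W)%N by rewrite /W; lia.
have zero a : (2 < a)%N -> ints (input I) a 0 = 0%N by case: a => [|[|[|]]].
have [t [s' [l [CT [BIG [ex tle [l0 _ lmn] _ _]]]]]] :=
  algo_run z zero (@input_wt_ge0 R I) (fun c => lexx 0) (ncen_gt0 I) (ncen_le I).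
exists t, s'; split=> //; apply: H => //; first exact: ncen_gt0.
apply: steps_le tle => //; first exact: ncen_gt0.
apply: (leq_trans lmn); rewrite /= -[in X in (_ <= X)%N]mulnn -/W.
rewrite -[wsize _]/W; have := leq_mul mW nW; have := leq_mul W0 W0; lia.
Qed.

Theorem theorem1p1 (R : realType) :
  exists eta0 : R, 6 / 10 ^+ 4 < eta0 /\
    forall z : nat, (0 < z)%N ->
      exists A : cmd, fpt_time R A /\ approximates A z (3 ^+ z * (1 - eta0)).
Proof.
exists (1 / 100); split; first by lra.
move=> z z0; exists (algo z); split; first exact: algo_fpt_time.
exact: algo_approximates.
Qed.
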